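(* Let $(R,\mathfrak{m})$ be a Noetherian local ring and $I$ an ideal of $R$. There exists $N>0$ such that for every ideal $J\subseteq R$ satisfying (i) $I+\mathfrak{m}^N=J+\mathfrak{m}^N$, (ii) $\dim(R/J)=\dim(R/I)=d$, (iii) $R/J$ is Cohen–Macaulay, (iv) $\operatorname{depth}\mathrm{gr}_{\mathfrak{m}}(R/J)\ge d-1$, the rings $R/I$ and $R/J$ have the same Hilbert function.
   Context: For an ideal $I$, $\mathrm{gr}_{\mathfrak{m}}(R/I)=\bigoplus_{n\ge0}\mathfrak{m}^n(R/I)/\mathfrak{m}^{n+1}(R/I)$, and the Hilbert function of $R/I$ is $n\mapsto\dim_k\mathfrak{m}^n(R/I)/\mathfrak{m}^{n+1}(R/I)$, $k=R/\mathfrak{m}$. The depth of $\mathrm{gr}_{\mathfrak{m}}(R/J)$ is taken with respect to its homogeneous maximal ideal. *)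

(* Defs.v *)
From HB Require Import structures.
From mathcomp Require Import all_boot all_order all_algebra.
Set Implicit Arguments. Unset Strict Implicit. Unset Printing Implicit Defensive.
Import Order.TTheory GRing.Theory Num.Theory.
Local Open Scope ring_scope.

Section CommAlg.
Variable R : comNzRingType.

Definition subsetR := R -> Prop.

Definition seteqR (A B : subsetR) : Prop := forall x, A x <-> B x.

Definition is_ideal (I : subsetR) : Prop :=
  [/\ I 0, (forall a b, I a -> I b -> I (a + b)) & (forall r a, I a -> I (r * a))].

Definition proper_ideal (I : subsetR) : Prop := is_ideal I /\ ~ I 1.

Definition is_prime (P : subsetR) : Prop :=
  proper_ideal P /\ (forall a b, P (a * b) -> P a \/ P b).

Definition is_maximal (M : subsetR) : Prop :=
  proper_ideal M /\
  (forall N, proper_ideal N -> (forall x, M x -> N x) -> seteqR N M).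

Definition noetherian : Prop :=
  forall C : nat -> subsetR, (forall k, is_ideal (C k)) ->
    (forall k x, C k x -> C k.+1 x) ->
    exists n, forall k, (n <= k)%N -> seteqR (C k) (C n).

Definition local_with (m : subsetR) : Prop :=
  is_maximal m /\ forall M, is_maximal M -> seteqR M m.

Definition isum (I J : subsetR) : subsetR :=
  fun x => exists a b, [/\ I a, J b & x = a + b].

Definition iprod (I J : subsetR) : subsetR :=
  fun x => exists s : seq (R * R),
    (forall p, p \in s -> I p.1 /\ J p.2) /\ x = \sum_(p <- s) p.1 * p.2.

Fixpoint ipow (m : subsetR) (n : nat) : subsetR :=
  match n with
  | 0 => fun _ => True
  | n'.+1 => iprod m (ipow m n')
  end.

Definition igen (xs : seq R) : subsetR :=
  fun y => exists c : seq R, size c = size xs /\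
    y = \sum_(i < size xs) c`_i * xs`_i.

Definition prime_chain (I : subsetR) (d : nat) (P : nat -> subsetR) : Prop :=
  (forall i, (i <= d)%N -> is_prime (P i) /\ forall x, I x -> P i x) /\
  (forall i, (i < d)%N ->
     (forall x, P i x -> P i.+1 x) /\ exists x, P i.+1 x /\ ~ P i x).

Definition dim_quot (I : subsetR) (d : nat) : Prop :=
  (exists P, prime_chain I d P) /\ ~ (exists P, prime_chain I d.+1 P).

Definition regseq (m J : subsetR) (xs : seq R) : Prop :=
  (forall x, x \in xs -> m x) /\
  (forall i, (i < size xs)%N -> forall y,
     isum J (igen (take i xs)) (xs`_i * y) -> isum J (igen (take i xs)) y) /\
  ~ isum J (igen xs) 1.

Definition depth_quot (m J : subsetR) (t : nat) : Prop :=
  (exists xs, size xs = t /\ regseq m J xs) /\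
  (forall xs, regseq m J xs -> (size xs <= t)%N).

Definition cohen_macaulay_quot (m J : subsetR) : Prop :=
  exists t, depth_quot m J t /\ dim_quot J t.

(* Hilbert function of R/I at n equals r: the k-vector space
   m^n(R/I)/m^(n+1)(R/I) = (m^n + I)/(m^(n+1) + I), k = R/m, has a basis of
   size r (represented by elements of m^n + I). *)
Definition hilbert_fun (m I : subsetR) (n r : nat) : Prop :=
  exists s : seq R, [/\ size s = r,
    (forall x, x \in s -> isum (ipow m n) I x),
    (forall c : seq R, size c = r ->
       isum (ipow m n.+1) I (\sum_(i < r) c`_i * s`_i) ->
       forall i, (i < r)%N -> m c`_i) &
    (forall y, isum (ipow m n) I y ->
       exists c : seq R, size c = r /\
         isum (ipow m n.+1) I (y - \sum_(i < r) c`_i * s`_i))].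

(* ---- associated graded ring gr_m(R/J) ----
   An element is represented by f : nat -> R, f n representing the degree-n
   component, a class in (m^n + J)/(m^(n+1) + J); only finitely many
   components are nonzero. *)
Definition grElt (m J : subsetR) (f : nat -> R) : Prop :=
  (forall n, isum (ipow m n) J (f n)) /\
  exists B, forall n, (B <= n)%N -> isum (ipow m n.+1) J (f n).

Definition grEq (m J : subsetR) (f g : nat -> R) : Prop :=
  forall n, isum (ipow m n.+1) J (f n - g n).

Definition grMul (f g : nat -> R) : nat -> R :=
  fun n => \sum_(i < n.+1) f i * g (n - i)%N.

Definition grPlus (m J : subsetR) (f : nat -> R) : Prop :=
  isum (ipow m 1) J (f 0%N).

Definition gr0 : nat -> R := fun _ => 0.

Definition grIdeal (m J : subsetR) (xs : seq (nat -> R)) (y : nat -> R) : Prop :=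
  exists a : seq (nat -> R), [/\ size a = size xs,
    (forall i, (i < size a)%N -> grElt m J (nth gr0 a i)) &
    grEq m J y (fun n => \sum_(i < size xs) grMul (nth gr0 a i) (nth gr0 xs i) n)].

Definition gr_regseq (m J : subsetR) (xs : seq (nat -> R)) : Prop :=
  (forall i, (i < size xs)%N -> grElt m J (nth gr0 xs i) /\ grPlus m J (nth gr0 xs i)) /\
  (forall i, (i < size xs)%N -> forall y, grElt m J y ->
     grIdeal m J (take i xs) (grMul (nth gr0 xs i) y) -> grIdeal m J (take i xs) y) /\
  (exists y, grElt m J y /\ ~ grIdeal m J xs y).

Definition gr_depth_ge (m J : subsetR) (k : nat) : Prop :=
  exists xs, (k <= size xs)%N /\ gr_regseq m J xs.

End CommAlg.

(* Main.v *)
Require Import Defs.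
From mathcomp Require Import all_boot all_order all_algebra.
From mathcomp Require Import ring zify.
From Stdlib Require Import Classical ClassicalEpsilon.

(* Write F_n = m^n + J and let H_J be the Hilbert function of R/J.  Choose x_1, ..., x_d with x_j
   in m^(c_j), c_j > 0, whose initial forms generate an ideal of gr_m(R/I) containing everything
   of degree >= n0; by Nakayama the same x and n0 work for J as soon as I and J agree modulo
   m^(n0+1).  Since R/J is Cohen-Macaulay, H_i(x; R/J) = 0 for i >= 1, and since the depth of
   gr_m(R/J) is at least d - 1, H_i(x^*; gr_m(R/J)) = 0 for i >= 2, where x^* denotes the initial
   forms.  Filter the Koszul complex of R/J by the subcomplexes K^(n) with components
   F_(n - weight): the second vanishing makes H_1(K^(n+1)) -> H_1(K^(n)) injective for all n, so
   H_i(K^(n)) = 0 for all i >= 1, while H_0(K^(n)) = 0 for n >= n0 by the choice of x.  Hence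
   the Koszul complex of gr_m(R/J) is exact in degrees >= n0, a bound that does not depend on J.
   For I itself it is exact in large degrees, because Koszul homology is finitely generated and
   killed by x^*.  Euler characteristics turn exactness into one linear recurrence satisfied by
   both H_I and H_J from a common degree on; agreeing up to that degree, they coincide. *)

Set Implicit Arguments. Unset Strict Implicit. Unset Printing Implicit Defensive.
Import GRing.Theory.

(** Depth d - 1 leaves H_1 of the Koszul complex of gr_m(R/J) uncontrolled. The filtration argument
    uses the graded side only in homological degrees >= 2, and what is missing is supplied by H_1 of
    R/J itself. The bound on the exact degrees then comes from H_0 alone, which Nakayama controls
    uniformly in J. The x_j come from homogeneous prime avoidance in the Rees algebra. Over a finite
    residue field linear forms may fail to avoid the primes, hence the degrees c_j and the weights
    in the Koszul complex. Each x_j avoids two families: primes that govern filter-regularity on the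
    graded ring, so that initial forms modulo I + (x_j) stay under control, and the primes other
    than m that detect the dimension, so that the dimension drops. No quotient ring or residue field
    is formed. A module is a numerator and a denominator inside an ambient ring or module; gr_m(R/J)
    is a quotient of subsets of R[T]; homological degree and weight are tracked by predicates on the
    components. *)

Section Ideals.
Local Open Scope ring_scope.
Variable R : comNzRingType.
Implicit Types (A B I J m : R -> Prop).

Lemma ideal0 I : is_ideal I -> I 0. Proof. by case. Qed.
Lemma idealD I a b : is_ideal I -> I a -> I b -> I (a + b).
Proof. by case=> _ + _; apply. Qed.
Lemma idealM I r a : is_ideal I -> I a -> I (r * a).
Proof. by case=> _ _; apply. Qed.
Lemma idealMR I r a : is_ideal I -> I a -> I (a * r).
Proof. by rewrite mulrC; apply: idealM. Qed.
Lemma idealN I a : is_ideal I -> I a -> I (- a).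
Proof. by rewrite -mulN1r; apply: idealM. Qed.
Lemma idealB I a b : is_ideal I -> I a -> I b -> I (a - b).
Proof. by move=> iI Ia Ib; apply: idealD => //; apply: idealN. Qed.
Lemma idealBr I a b : is_ideal I -> I b -> I (a - b) -> I a.
Proof. by move=> iI Ib Iab; rewrite -(subrK b a); apply: idealD. Qed.
Lemma ideal_sum I (T : Type) (s : seq T) (P : pred T) (f : T -> R) :
  is_ideal I -> (forall i, P i -> I (f i)) -> I (\sum_(i <- s | P i) f i).
Proof.
move=> iI If; apply: (big_ind I) => //; first exact: ideal0.
by move=> x y; apply: idealD.
Qed.

Lemma isum_ideal A B : is_ideal A -> is_ideal B -> is_ideal (isum A B).
Proof.
move=> iA iB; split.
- by exists 0, 0; rewrite addr0; split=> //; apply: ideal0.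
- move=> _ _ [a [b [Aa Bb ->]]] [a' [b' [Aa' Bb' ->]]].
  by exists (a + a'), (b + b'); split; [apply: idealD|apply: idealD|rewrite addrACA].
- move=> r _ [a [b [Aa Bb ->]]]; exists (r * a), (r * b).
  by split; [apply: idealM|apply: idealM|rewrite mulrDr].
Qed.

Lemma isum_l A B x : is_ideal B -> A x -> isum A B x.
Proof. by move=> iB Ax; exists x, 0; rewrite addr0; split=> //; apply: ideal0. Qed.
Lemma isum_r A B x : is_ideal A -> B x -> isum A B x.
Proof. by move=> iB Ax; exists 0, x; rewrite add0r; split=> //; apply: ideal0. Qed.
Lemma isum_min A B I : is_ideal I -> (forall x, A x -> I x) ->
  (forall x, B x -> I x) -> forall x, isum A B x -> I x.
Proof. by move=> iI AI BI _ [a [b [/AI Ia /BI Ib ->]]]; apply: idealD. Qed.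

Lemma iprod_mul A B x y : A x -> B y -> iprod A B (x * y).
Proof.
move=> Ax By; exists [:: (x, y)]; rewrite big_seq1; split=> // p.
by rewrite inE => /eqP->.
Qed.

Lemma iprod_min A B I : is_ideal I -> (forall x y, A x -> B y -> I (x * y)) ->
  forall z, iprod A B z -> I z.
Proof.
move=> iI ABI _ [s [sAB ->]]; rewrite big_seq.
by apply: ideal_sum => // p /sAB[Ap Bp]; apply: ABI.
Qed.

Lemma iprod_ideal A B : is_ideal A -> is_ideal (iprod A B).
Proof.
move=> iA; split.
- by exists [::]; rewrite big_nil; split=> // p.
- move=> _ _ [s [sAB ->]] [t [tAB ->]]; exists (s ++ t); rewrite big_cat; split=> // p.
  by rewrite mem_cat => /orP[/sAB|/tAB].
- move=> r _ [s [sAB ->]]; exists [seq (r * p.1, p.2) | p <- s]; split.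
    by move=> _ /mapP[p /sAB[Ap Bp] ->]; split=> //; apply: idealM.
  by rewrite big_map mulr_sumr; apply: eq_bigr => p _; rewrite mulrA.
Qed.

Lemma ipow_ideal m n : is_ideal m -> is_ideal (ipow m n).
Proof. by case: n => [|n] im //=; apply: iprod_ideal. Qed.

Lemma ipow_mul m a b x y : is_ideal m ->
  ipow m a x -> ipow m b y -> ipow m (a + b) (x * y).
Proof.
move=> im; elim: a x => [|a IH] x; first by move=> _; apply: idealM; apply: ipow_ideal.
move=> ax yb; have ip := ipow_ideal (a + b).+1 im.
suff H : ipow m (a + b).+1 (x * y) by [].
have iq : is_ideal (fun x => ipow m (a + b).+1 (x * y)).
  split; [by rewrite mul0r; apply: ideal0|by move=> u v; rewrite mulrDl; apply: idealD|].
  by move=> r u; rewrite -mulrA; apply: idealM.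
apply: (iprod_min iq _ ax) => u v mu av.
by rewrite -mulrA; apply: iprod_mul => //; apply: IH.
Qed.

Lemma ipowS_mul m n a y : m a -> ipow m n y -> ipow m n.+1 (a * y).
Proof. exact: iprod_mul. Qed.

Lemma ipow1 m a : m a -> ipow m 1 a.
Proof. by move=> ma; rewrite -[a]mulr1; apply: iprod_mul. Qed.

Lemma ipow1E m : is_ideal m -> seteqR (ipow m 1) m.
Proof.
move=> im x; split; last exact: ipow1.
by apply: iprod_min => // a b ma _; apply: idealMR.
Qed.

Lemma ipow_exp m c x k : is_ideal m -> ipow m c x -> ipow m (c * k) (x ^+ k).
Proof.
move=> im cx; elim: k => [|k IH]; first by rewrite muln0.
by rewrite mulnS exprS; apply: ipow_mul.
Qed.

Lemma ipow_leq m a b x : is_ideal m -> (a <= b)%N -> ipow m b x -> ipow m a x.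
Proof.
move=> im /subnK<-; elim: (b - a)%N x => [|k IH] x //.
move=> H; apply: IH; move: x H; apply: iprod_min; first exact: ipow_ideal.
by move=> x y _; apply: idealM; apply: ipow_ideal.
Qed.

Lemma ipow_min_add m a b I : is_ideal m -> is_ideal I ->
  (forall x y, ipow m a x -> ipow m b y -> I (x * y)) ->
  forall z, ipow m (a + b) z -> I z.
Proof.
move=> im iI; elim: a b => [|a IH] b H z; first by move=> bz; rewrite -[z]mul1r; apply: H.
rewrite addSnnS; apply: IH => x y ax.
have iq : is_ideal (fun y => I (x * y)).
  split; [by rewrite mulr0; apply: ideal0|by move=> u v; rewrite mulrDr; apply: idealD|].
  by move=> r u; rewrite mulrCA; apply: idealM.
apply: (iprod_min iq) => u v mu bv; rewrite mulrA; apply: H => //.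
by rewrite mulrC; apply: ipowS_mul.
Qed.

Lemma powsum_ideal m J n : is_ideal m -> is_ideal J -> is_ideal (isum (ipow m n) J).
Proof. by move=> im iJ; apply: isum_ideal => //; apply: ipow_ideal. Qed.

Lemma powsum_mul m J a b x y : is_ideal m -> is_ideal J ->
  isum (ipow m a) J x -> isum (ipow m b) J y -> isum (ipow m (a + b)) J (x * y).
Proof.
move=> im iJ [x1 [x2 [mx Jx ->]]] [y1 [y2 [my Jy ->]]].
exists (x1 * y1), (x1 * y2 + x2 * (y1 + y2)); split; first exact: ipow_mul.
  by apply: idealD => //; [apply: idealM|apply: idealMR].
by rewrite mulrDl mulrDr addrA.
Qed.

Lemma powsum_leq m J a b x : is_ideal m -> (a <= b)%N ->
  isum (ipow m b) J x -> isum (ipow m a) J x.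
Proof.
by move=> im ab [u [v [mu Jv ->]]]; exists u, v; split=> //; apply: ipow_leq ab mu.
Qed.

End Ideals.

Section WellFounded.

Lemma no_chain_wf (X : Type) (r : X -> X -> Prop) :
  (forall f : nat -> X, ~ forall n, r (f n.+1) (f n)) -> well_founded r.
Proof.
move=> nochain x; apply: NNPP => nAx.
have step (u : {y | ~ Acc r y}) : exists v : {y | ~ Acc r y}, r (sval v) (sval u).
  case: u => y nAy /=; apply: NNPP => H; apply: nAy; constructor => z rzy.
  by apply: NNPP => nAz; apply: H; exists (exist _ z nAz).
pose nxt u := sval (constructive_indefinite_description _ (step u)).
have nxtP u : r (sval (nxt u)) (sval u).
  by rewrite /nxt; case: constructive_indefinite_description.
by apply: (nochain (fun n => sval (iter n nxt (exist _ x nAx)))) => n; apply: nxtP.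
Qed.

Lemma wf_minimal (X : Type) (r : X -> X -> Prop) (P : X -> Prop) :
  well_founded r -> (exists x, P x) -> exists2 x, P x & forall y, r y x -> ~ P y.
Proof.
move=> wf [x]; elim/(well_founded_ind wf): x => x IH Px.
case: (classic (exists2 y, r y x & P y)) => [[y ryx Py]|H]; first exact: IH Py.
by exists x => // y ryx Py; apply: H; exists y.
Qed.

End WellFounded.

(** * Noetherian induction and the Hilbert basis theorem *)

Section Noetherian.
Local Open Scope ring_scope.

(** The larger ideal is the first argument, so that well-foundedness is the ascending chain
    condition and induction proceeds from larger ideals to smaller ones. *)
Definition sub_ideal_gt (R : comNzRingType) (B A : R -> Prop) :=
  [/\ is_ideal A, is_ideal B, (forall x, A x -> B x) & ~ (forall x, B x -> A x)].

Lemma noetherian_wf (R : comNzRingType) :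
  noetherian R -> well_founded (@sub_ideal_gt R).
Proof.
move=> nR; apply: no_chain_wf => f H.
have [|k x|n Hn] := nR f; [by move=> k; case: (H k)|by case: (H k) => _ _ + _; apply|].
by case: (H n) => _ _ _; apply=> x; apply: (Hn n.+1 (leqnSn n) x).1.
Qed.

Section HilbertBasis.
Variable S : comNzRingType.
Hypothesis nS : noetherian S.

Definition lead_ideal (C : {poly S} -> Prop) (i : nat) (a : S) :=
  exists p, [/\ C p, (size p <= i.+1)%N & p`_i = a].

Lemma lead_ideal_ideal C i : is_ideal C -> is_ideal (lead_ideal C i).
Proof.
move=> iC; split.
- by exists 0; rewrite size_poly0 coef0; split=> //; apply: ideal0.
- move=> _ _ [p [Cp sp <-]] [q [Cq sq <-]]; exists (p + q).
  split; [exact: idealD| |exact: coefD].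
  by apply: (leq_trans (size_polyD _ _)); rewrite geq_max sp sq.
- move=> r _ [p [Cp sp <-]]; exists (r%:P * p); split; [exact: idealM| |exact: coefCM].
  by rewrite mul_polyC; apply: leq_trans (size_scale_leq _ _) sp.
Qed.

Lemma lead_idealS C i a : is_ideal C -> lead_ideal C i a -> lead_ideal C i.+1 a.
Proof.
move=> iC [p [Cp sp <-]]; exists (p * 'X); split; first exact: idealMR.
  by apply: (leq_trans (size_polyMleq _ _)); rewrite size_polyX addn2.
by rewrite coefMX.
Qed.

Lemma lead_ideal_leq C i j a : is_ideal C -> (i <= j)%N -> lead_ideal C i a -> lead_ideal C j a.
Proof.
move=> iC /subnK<-; elim: (j - i)%N => // k IH H.
by rewrite addSn; apply: lead_idealS => //; apply: IH.
Qed.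

(** Subtracting from an element of [D] one of [C] with the same leading term lowers the size, so
    comparing leading coefficients degree by degree is enough. *)
Lemma lead_ideal_sub C D : (forall p, C p -> D p) -> is_ideal C -> is_ideal D ->
  (forall i a, lead_ideal D i a -> lead_ideal C i a) -> forall p, D p -> C p.
Proof.
move=> CD iC iD H p; have [n] := ubnP (size p); elim: n p => // n IH p sp Dp.
have [->|p0] := eqVneq p 0; first exact: ideal0.
case/(_ (size p).-1 (lead_coef p)): H => [|q [Cq sq lq]].
  by exists p; split=> //; case: (size p).
apply: (idealBr iC Cq); apply: IH; last by apply: idealB => //; apply: CD.
have sp0 : (0 < size p)%N by rewrite size_poly_gt0.
rewrite prednK // in sq.
apply: (@leq_ltn_trans (size p).-1); last by rewrite prednK.
apply/leq_sizeP => j; rewrite leq_eqVlt => /predU1P[<-|lj].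
  by rewrite coefB lq lead_coefE subrr.
have lj' : (size p <= j)%N by rewrite -(prednK sp0).
by rewrite coefB !nth_default ?subrr // (leq_trans sq).
Qed.

Lemma noetherian_poly : noetherian {poly S}.
Proof.
move=> C iC incC.
have inc k l : (k <= l)%N -> forall p, C k p -> C l p.
  by move/subnK<-; elim: (l - k)%N => // j IH p /IH; apply: incC.
have incL k l i j a : (k <= l)%N -> (i <= j)%N ->
    lead_ideal (C k) i a -> lead_ideal (C l) j a.
  move=> kl ij /(lead_ideal_leq (iC k) ij)[p [Cp sp pa]]; exists p.
  by split=> //; apply: inc Cp.
(* The diagonal chain settles all degrees >= K at once; the finitely many degrees below K are
   stabilised one by one. *)
have [k|k a|K HK] := nS (C := fun k => lead_ideal (C k) k).
- exact: lead_ideal_ideal.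
- exact: incL.
have stab i : exists n, forall k, (n <= k)%N -> seteqR (lead_ideal (C k) i) (lead_ideal (C n) i).
  apply: nS => [k|k a]; [exact: lead_ideal_ideal|exact: incL].
have [M HM] : exists M, forall i, (i < K)%N -> forall k, (M <= k)%N ->
    forall a, lead_ideal (C k) i a -> lead_ideal (C M) i a.
  elim: {1}K => [|j [M HM]]; first by exists 0%N.
  have [n Hn] := stab j; exists (maxn M n) => i; rewrite ltnS leq_eqVlt => /predU1P[->|ij] k.
    move=> lek a La; apply: (incL n _ j) => //; first exact: leq_maxr.
    by apply: (Hn k _ a).1 La; apply: leq_trans lek; apply: leq_maxr.
  move=> lek a La; apply: (incL M _ i) => //; first exact: leq_maxl.
  by apply: HM La => //; apply: leq_trans lek; apply: leq_maxl.
exists (maxn M K) => k lek p; split; last exact: inc.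
apply: lead_ideal_sub => //; first exact: inc.
move=> i a La; have [iK|Ki] := ltnP i K.
  apply: (incL M _ i) => //; first exact: leq_maxl.
  by apply: HM La => //; apply: leq_trans lek; apply: leq_maxl.
apply: (incL K _ K) => //; first exact: leq_maxr.
apply: (HK (maxn k i) _ a).1; first by rewrite leq_max Ki orbT.
by apply: incL La; rewrite ?leq_maxl ?leq_maxr.
Qed.

End HilbertBasis.

End Noetherian.

Section FinitelyGenerated.
Local Open Scope ring_scope.
Variable R : comNzRingType.
Implicit Types (A B I : R -> Prop).

Definition adjoin A x : R -> Prop := fun y => exists r, A (y - r * x).

Lemma adjoin_ideal A x : is_ideal A -> is_ideal (adjoin A x).
Proof.
move=> iA; split; first by exists 0; rewrite mul0r subr0; apply: ideal0.
  move=> y z [r Ar] [s As]; exists (r + s).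
  by rewrite mulrDl opprD addrACA; apply: idealD.
by move=> t y [r Ar]; exists (t * r); rewrite -mulrA -mulrBr; apply: idealM.
Qed.
Lemma adjoin_sub A x y : A y -> adjoin A x y.
Proof. by exists 0; rewrite mul0r subr0. Qed.
Lemma adjoin_mem A x : is_ideal A -> adjoin A x x.
Proof. by exists 1; rewrite mul1r subrr; apply: ideal0. Qed.
Lemma adjoin_gt A x : is_ideal A -> ~ A x -> sub_ideal_gt (adjoin A x) A.
Proof.
move=> iA nAx; split=> //; [exact: adjoin_ideal|by move=> y; apply: adjoin_sub|].
by move=> H; apply: nAx; apply: H; apply: adjoin_mem.
Qed.

Definition fgen (xs : seq R) y := exists c : nat -> R, y = \sum_(i < size xs) c i * xs`_i.

Lemma fgen_cons x xs y r : fgen xs (y - r * x) -> fgen (x :: xs) y.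
Proof.
case=> c e; exists (fun i => if i is i'.+1 then c i' else r).
by rewrite big_ord_recl /= -e addrC subrK.
Qed.

(** Among the ideals spanned by finitely many elements of [A] take a maximal one: an element of [A]
    outside it could be adjoined. *)
Lemma noetherian_fg A : noetherian R -> is_ideal A ->
  exists xs : seq R, (forall x, x \in xs -> A x) /\ forall y, A y -> fgen xs y.
Proof.
move=> nR iA.
pose P B := is_ideal B /\ exists xs, (forall x, x \in xs -> A x) /\ forall y, B y -> fgen xs y.
have [|B [iB [xs [xsA Bxs]]] maxB] := wf_minimal (P := P) (noetherian_wf nR).
  exists (fun y => y = 0); split.
    by split=> // [? ? -> ->|? ? ->]; rewrite ?addr0 ?mulr0.
  by exists [::]; split=> // y ->; exists (fun=> 0); rewrite big_ord0.
exists xs; split=> // y Ay; apply: (Bxs); apply: NNPP => nBy.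
apply: (maxB _ (adjoin_gt iB nBy)); split; first exact: adjoin_ideal.
exists (y :: xs); split; first by move=> x; rewrite inE => /predU1P[->|/xsA].
by move=> z [r Bzr]; apply: (@fgen_cons _ _ _ r); apply: Bxs.
Qed.

End FinitelyGenerated.

(** * The Rees algebra R[mT] and stabilisation of its homogeneous ideals *)

Section Rees.
Local Open Scope ring_scope.
Variable R : comNzRingType.
Hypothesis nR : noetherian R.

Definition rees_mem (m : R -> Prop) (f : {poly R}) := forall n, ipow m n f`_n.

Lemma rees_memC m r : is_ideal m -> rees_mem m r%:P.
Proof. by move=> im n; rewrite coefC; case: n => //= n; apply: (@ideal0 _ (ipow m n.+1)); apply: ipow_ideal. Qed.
Lemma rees_memD m f g : is_ideal m -> rees_mem m f -> rees_mem m g -> rees_mem m (f + g).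
Proof. by move=> im mf mg n; rewrite coefD; apply: idealD => //; apply: ipow_ideal. Qed.
Lemma rees_memM m f g : is_ideal m -> rees_mem m f -> rees_mem m g -> rees_mem m (f * g).
Proof.
move=> im mf mg n; rewrite coefM; apply: ideal_sum; first exact: ipow_ideal.
by move=> i _; rewrite -[n in ipow m n](subnKC (leq_ord i)); apply: ipow_mul.
Qed.
Lemma rees_memZXn m a n : is_ideal m -> ipow m n a -> rees_mem m (a *: 'X^n).
Proof.
move=> im ma k; rewrite coefZ coefXn; have [->|_] := eqVneq; first by rewrite mulr1.
by rewrite mulr0; apply: ideal0; apply: ipow_ideal.
Qed.
Lemma rees_mem_sum m (T : Type) (s : seq T) (f : T -> {poly R}) : is_ideal m ->
  (forall i, rees_mem m (f i)) -> rees_mem m (\sum_(i <- s) f i).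
Proof.
move=> im mf; apply: (big_ind (rees_mem m)) => //; first exact: rees_memC.
by move=> ? ?; apply: rees_memD.
Qed.

(** R[mT] is covered by a polynomial ring over R with one variable for each entry of [a], sent to
    that entry times T. [S] is an iterated [{poly _}], hence noetherian by the Hilbert basis
    theorem. *)
Lemma rees_cover (a : seq R) : exists (S : comNzRingType) (phi : {rmorphism S -> {poly R}}),
  [/\ noetherian S, (forall r, exists p, phi p = r%:P),
    (forall x, x \in a -> exists p, phi p = x *: 'X) &
    (forall m, is_ideal m -> (forall x, x \in a -> m x) -> forall p, rees_mem m (phi p))].
Proof.
elim: a => [|x a [S [phi [nS phiC phiX phim]]]].
  exists R, (@polyC R); split=> // [r|m im _ p]; first by exists r.
  exact: rees_memC.
have cu : commr_rmorph phi (x *: 'X) by move=> p; apply: mulrC.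
exists {poly S}, (horner_morph cu); split; first exact: noetherian_poly.
- by move=> r; have [p <-] := phiC r; exists p%:P; apply: horner_morphC.
- move=> y; rewrite inE => /predU1P[->|/phiX[p <-]].
    by exists 'X; apply: horner_morphX.
  by exists p%:P; apply: horner_morphC.
- move=> m im am p; have mx : m x by apply: am; rewrite mem_head.
  have {}phim q : rees_mem m (phi q).
    by apply: phim => // y ya; apply: am; rewrite inE ya orbT.
  change (rees_mem m (map_poly phi p).[x *: 'X]); rewrite horner_coef.
  apply: rees_mem_sum => // i.
  rewrite coef_map exprZn; apply: rees_memM => //; first exact: phim.
  apply: rees_memZXn => //.
  by rewrite -[X in ipow m X]mul1n; apply: ipow_exp => //; apply: ipow1.
Qed.

(* A homogeneous ideal of the Rees algebra R[mT]: only the intersections of L n with m^n matter. *)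
Definition gfam (m : R -> Prop) (L : nat -> R -> Prop) :=
  (forall n, is_ideal (L n)) /\ (forall a n y, m a -> L n y -> L n.+1 (a * y)).

Lemma gfam_pow m L k a n y : gfam m L -> ipow m k a -> L n y -> L (k + n)%N (a * y).
Proof.
move=> [iL mL]; elim: k a n y => [|k IH] a n y; first by move=> _; apply: idealM.
move=> ka Ly; have iq : is_ideal (fun a => L (k.+1 + n)%N (a * y)).
  split; [by rewrite mul0r; apply: ideal0|by move=> u v; rewrite mulrDl; apply: idealD|].
  by move=> r u; rewrite -mulrA; apply: idealM.
by apply: (iprod_min iq _ ka) => u v mu kv; rewrite -mulrA addSn; apply: mL => //; apply: IH.
Qed.

(** The Rees algebra inherits the chain condition from its polynomial cover: the homogeneous ideals
    are pulled back along [phi], and the stable index is read off on monomials y T^n, which all have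
    preimages. *)
Lemma rees_acc m (C : nat -> nat -> R -> Prop) : is_ideal m -> (forall k, gfam m (C k)) ->
  (forall k n y, ipow m n y -> C k n y -> C k.+1 n y) ->
  exists K, forall k, (K <= k)%N -> forall n y, ipow m n y -> C k n y -> C K n y.
Proof.
move=> im gC incC.
have [xs [xsm mxs]] := noetherian_fg nR im.
have [S [phi [nS phiC phiX phim]]] := rees_cover xs.
have {}phim : forall p, rees_mem m (phi p) by apply: phim.
have img_ideal n : is_ideal (fun y => exists p, phi p = y *: 'X^n).
  split; first by exists 0; rewrite rmorph0 scale0r.
    by move=> u v [p ep] [q eq]; exists (p + q); rewrite rmorphD ep eq scalerDl.
  move=> r u [p ep]; have [q eq] := phiC r; exists (q * p).
  by rewrite rmorphM ep eq mul_polyC scalerA.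
have liftm y : m y -> exists p, phi p = y *: 'X.
  move=> /mxs[c ->]; have := img_ideal 1%N; rewrite expr1 => ii.
  apply: (ideal_sum (I := fun y => exists p, phi p = y *: 'X)) => // i _.
  by apply: (idealM (I := fun y => exists p, phi p = y *: 'X)) => //; apply: phiX; apply: mem_nth.
have lift n y : ipow m n y -> exists p, phi p = y *: 'X^n.
  elim: n y => [|n IH] y; first by move=> _; have [p ep] := phiC y; exists p; rewrite ep expr0 alg_polyC.
  apply: (iprod_min (img_ideal n.+1)) => a b /liftm[p ep] /IH[q eq]; exists (p * q).
  by rewrite rmorphM ep eq -scalerAl -scalerAr scalerA -exprS.
have iD k : is_ideal (fun p => forall n, C k n (phi p)`_n).
  have [iC _] := gC k; split.
  - by move=> n; rewrite rmorph0 coef0; apply: ideal0.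
  - by move=> p q Cp Cq n; rewrite rmorphD coefD; apply: idealD.
  - move=> q p Cp n; rewrite rmorphM coefM; apply: ideal_sum => // i _.
    by rewrite -[n in C k n](subnKC (leq_ord i)); apply: gfam_pow => //; apply: phim.
have [//|k p Cp n|K HK] := nS (fun k p => forall n, C k n (phi p)`_n).
  by apply: incC => //; apply: phim.
exists K => k Kk n y ny Cy; have [p ep] := lift n y ny.
have /(_ n) : forall n, C K n (phi p)`_n.
  apply/(HK k Kk p) => i; rewrite ep coefZ coefXn.
  have [->|_] := eqVneq; first by rewrite mulr1.
  by rewrite mulr0; apply: ideal0; case: (gC k).
by rewrite ep coefZ coefXn eqxx mulr1.
Qed.

Definition gfam_gt m (B A : nat -> R -> Prop) :=
  [/\ gfam m A, gfam m B, (forall n y, ipow m n y -> A n y -> B n y) &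
    exists n y, [/\ ipow m n y, B n y & ~ A n y]].

Lemma gfam_wf m : is_ideal m -> well_founded (gfam_gt m).
Proof.
move=> im; apply: no_chain_wf => f H.
have [|k n y|K HK] := rees_acc (C := f) im; [by move=> k; case: (H k)|by case: (H k) => _ _ + _; apply|].
case: (H K) => _ _ _ [n [y [ny By]]]; apply.
exact: HK By.
Qed.

(** A homogeneous ideal of the Rees algebra is generated in bounded degrees; beyond the bound each
    graded piece is m times the preceding one. *)
Lemma rees_stab m Q : is_ideal m -> gfam m Q ->
  exists D, forall n, (D <= n)%N -> forall y, ipow m n.+1 y -> Q n.+1 y ->
    iprod m (fun z => ipow m n z /\ Q n z) y.
Proof.
move=> im [iQ mQ].
(* [C k] is the ideal generated by the part of [Q] in degrees <= k: in degree k + j it is m^j times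
   the piece of degree k. *)
pose T k := fix T j := if j is j'.+1 then iprod m (T j') else fun y => ipow m k y /\ Q k y.
pose C k n y := if (n <= k)%N then ipow m n y /\ Q n y else T k (n - k)%N y.
have i0 n : is_ideal (fun y => ipow m n y /\ Q n y).
  split; first by split; apply: ideal0 => //; apply: ipow_ideal.
    by move=> u v [? ?] [? ?]; split; apply: idealD => //; apply: ipow_ideal.
  by move=> u v [? ?]; split; apply: idealM => //; apply: ipow_ideal.
have iT k j : is_ideal (T k j) by case: j => [|j] /=; [exact: i0|exact: iprod_ideal].
have TS k j y : T k j.+1 y -> T k.+1 j y.
  elim: j y => [|j IH] y.
    apply: iprod_min; first exact: i0.
    by move=> u v mu [kv Qv]; split; [apply: ipowS_mul|apply: mQ].
  apply: iprod_min; first exact: iT.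
  by move=> u v mu /IH Tv; apply: iprod_mul.
have gC k : gfam m (C k).
  split=> [n|a n y ma]; rewrite /C; first by case: (n <= k)%N.
  have [nk [mny Qy]|kn] := leqP n k; last first.
    rewrite (leqNgt n.+1) ltnS (ltnW kn) /= subSn ?(ltnW kn) // => Ty.
    exact: iprod_mul.
  have [lt_nk|kn] := leqP n.+1 k; first by split; [apply: ipowS_mul|apply: mQ].
  have -> : k = n by move: nk kn; clear; lia.
  by rewrite subSnn; apply: iprod_mul.
have incC k n y : C k n y -> C k.+1 n y.
  rewrite /C; have [nk|kn] := leqP n k; first by rewrite (leq_trans nk).
  have [n1k|kn1] := leqP n k.+1.
    have -> : n = k.+1 by move: kn n1k; clear; lia.
    by rewrite subSnn; apply: (TS k 0%N).
  by rewrite -[(n - k)%N](subnSK kn); apply: TS.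
have [K HK] := rees_acc (C := C) im gC (fun k n y _ => @incC k n y).
exists K => n Kn y ny Qy.
have CK : C K n.+1 y by apply: (HK n.+1 (leqW Kn)) => //; rewrite /C leqnn.
(* The chain is constant from K <= n on, and in degree n + 1 the ideal [C n] is m times the piece of
   degree n. *)
have : C n n.+1 y.
  suff H k : C (k + K)%N n.+1 y by have := H (n - K)%N; rewrite subnK.
  by elim: k => // k IH; rewrite addSn; apply: incC.
by rewrite /C ltnn subSnn.
Qed.
End Rees.

(** * Homogeneous primes of the Rees algebra: filter-regular elements and prime avoidance *)

Section GradedPrimes.
Local Open Scope ring_scope.
Variable R : comNzRingType.
Hypothesis nR : noetherian R.
Variable m : R -> Prop.
Hypothesis im : is_ideal m.
Implicit Types (L P Q : nat -> R -> Prop).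

(** Primality is tested on homogeneous elements only. The last clause excludes primes containing the
    irrelevant ideal mT, which no element of positive degree could avoid. *)
Definition gprime P :=
  [/\ gfam m P,
    (forall i j a b, ipow m i a -> ipow m j b -> P (i + j)%N (a * b) -> P i a \/ P j b) &
    (exists2 a, m a & ~ P 1%N a)].

Definition gcolon L k z : nat -> R -> Prop := fun n a => L (n + k)%N (a * z).

Lemma gcolon_gfam L k z : gfam m L -> gfam m (gcolon L k z).
Proof.
move=> [iL mL]; split=> [n|a n y ma Ly]; rewrite /gcolon; last first.
  by rewrite addSn -mulrA; apply: mL.
split; [by rewrite mul0r; apply: ideal0|by move=> u v; rewrite mulrDl; apply: idealD|].
by move=> r u; rewrite -mulrA; apply: idealM.
Qed.

Definition gadjoin L k z : nat -> R -> Prop := fun n y =>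
  if (k <= n)%N then exists2 a, ipow m (n - k) a & L n (y - a * z) else L n y.

Lemma gadjoin_gfam L k z : gfam m L -> gfam m (gadjoin L k z).
Proof.
move=> [iL mL]; split=> [n|a n y ma]; rewrite /gadjoin.
  case: (k <= n)%N => //; have ip := ipow_ideal (n - k) im; split.
  - by exists 0; rewrite ?mul0r ?subr0; apply: ideal0.
  - move=> u v [a ia La] [b ib Lb]; exists (a + b); first exact: idealD.
    by rewrite mulrDl opprD addrACA; apply: idealD.
  - move=> r u [a ia La]; exists (r * a); first exact: idealM.
    by rewrite -mulrA -mulrBr; apply: idealM.
have [kn [b nb Lb]|nk Ly] := leqP k n.
  rewrite leqW //; exists (a * b); first by rewrite subSn //; apply: ipowS_mul.
  by rewrite -mulrA -mulrBr; apply: mL.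
case: ifP => _; last exact: mL.
by exists 0; [apply: ideal0; apply: ipow_ideal|rewrite mul0r subr0; apply: mL].
Qed.

Lemma gadjoin_sub L k z n y : L n y -> gadjoin L k z n y.
Proof.
move=> Ly; rewrite /gadjoin; case: ifP => // _.
by exists 0; [apply: ideal0; apply: ipow_ideal|rewrite mul0r subr0].
Qed.

Lemma gfam_irrelevant P n y : gfam m P -> (forall a, m a -> P 1%N a) ->
  (0 < n)%N -> ipow m n y -> P n y.
Proof.
case: n => // n gP mP _; apply: iprod_min => [|a b /mP Pa nb]; first by case: gP.
by rewrite mulrC -addn1; apply: (gfam_pow gP).
Qed.

(* A maximal proper colon (L : z) by a homogeneous z is prime; adjoin z to L and recurse. *)
Lemma filter_regular_criterion L : gfam m L ->
  exists (Ps : list (nat -> R -> Prop)) e, (forall P, List.In P Ps -> gprime P) /\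
  forall c x, ipow m c x -> (forall P, List.In P Ps -> ~ P c x) ->
  forall n, (e <= n)%N -> forall y, ipow m n y -> L (c + n)%N (x * y) -> L n y.
Proof.
elim/(well_founded_ind (gfam_wf nR im)): L => L IH gL.
case: (classic (exists k z, ipow m k z /\ ~ L k z)) => [[k0 [z0 [kz0 nLz0]]]|full]; last first.
  exists nil, 0%N; split=> // c x _ _ n _ y ny _; apply: NNPP => nLy.
  by apply: full; exists n, y.
pose isC A := exists k z, [/\ ipow m k z, ~ L k z & A = gcolon L k z].
have [|A [k [z [kz nLz AE]]] maxA] := wf_minimal (P := isC) (gfam_wf nR im).
  by exists (gcolon L k0 z0), k0, z0.
have gA : gfam m A by rewrite AE; apply: gcolon_gfam.
have prA i j a b : ipow m i a -> ipow m j b -> A (i + j)%N (a * b) -> A i a \/ A j b.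
  move=> ia jb Aab; case: (classic (A j b)) => Ab; [by right|left].
  apply: NNPP => nAa; rewrite AE in Aab Ab nAa.
  apply: (maxA (gcolon L (j + k)%N (b * z))); last first.
    by exists (j + k)%N, (b * z); split=> //; apply: ipow_mul.
  split=> //; first exact: gcolon_gfam.
    move=> n y ny; rewrite AE /gcolon => Ly.
    by rewrite addnCA mulrCA; apply: (gfam_pow gL).
  exists i, a; split=> //; last by rewrite AE.
  by rewrite /gcolon addnA mulrA.
have [|| Ps [e [prPs HPs]]] := IH (gadjoin L k z); [|exact: gadjoin_gfam|].
  split=> //; [exact: gadjoin_gfam|by move=> n y _; apply: gadjoin_sub|].
  exists k, z; split=> //; rewrite /gadjoin leqnn; exists 1; first by rewrite subnn.
  by rewrite mul1r subrr; apply: ideal0; case: gL.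
(* By induction y is u z modulo [L]; then x y in [L] puts x u in the colon [A], and y lies in [L] as
   soon as u lies in [A]. The bound k + 1 on n keeps u in positive degree. *)
have key c x n y : ipow m c x -> (forall P, List.In P Ps -> ~ P c x) ->
    (maxn e k.+1 <= n)%N -> ipow m n y -> L (c + n)%N (x * y) ->
    exists u, [/\ ipow m (n - k) u, A (c + (n - k))%N (x * u) &
                 (A (n - k)%N u -> L n y)].
  rewrite geq_max => cx xPs /andP[en kn] ny Lxy.
  have := HPs c x cx xPs n en y ny (gadjoin_sub _ _ Lxy).
  rewrite /gadjoin (ltnW kn) => -[u nku Lu]; exists u; split=> //.
    rewrite AE /gcolon -addnA subnK ?(ltnW kn) //.
    have -> : x * u * z = x * y - x * (y - u * z) by rewrite mulrBr opprB addrC subrK mulrA.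
    by case: gL => iL mL; apply: idealB => //; apply: (gfam_pow (conj iL mL)).
  rewrite AE /gcolon subnK ?(ltnW kn) // => Luz.
  by apply: idealBr Lu => //; case: gL.
case: (classic (exists2 a, m a & ~ A 1%N a)) => [relA|irrA].
  exists (A :: Ps)%list, (maxn e k.+1); split=> [P [<-|/prPs]//|c x cx xPs n en y ny Lxy].
  have [|u [nku Axu]] := key c x n y cx _ en ny Lxy; first by move=> P PPs; apply: xPs; right.
  by apply; have [|] := prA _ _ _ _ cx nku Axu => // /xPs[]; left.
(* Now [A] contains the irrelevant ideal, hence u, whose degree n - k is positive; this prime does
   not have to be avoided. *)
exists Ps, (maxn e k.+1); split=> // c x cx xPs n en y ny Lxy.
have [u [nku Axu]] := key c x n y cx xPs en ny Lxy; apply.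
apply: gfam_irrelevant => // [a ma|].
  by apply: NNPP => nAa; apply: irrA; exists a.
by move: en; rewrite geq_max subn_gt0 => /andP[].
Qed.

Lemma gprime_exp P c x k : gprime P -> ipow m c x -> (0 < k)%N ->
  P (c * k)%N (x ^+ k) -> P c x.
Proof.
move=> [gP prP _] cx; case: k => // k _; elim: k => [|k IH]; first by rewrite muln1.
by rewrite mulnS exprS => /prP[]//; apply: ipow_exp.
Qed.

Lemma gfam_exp P c x k : gfam m P -> ipow m c x -> (0 < k)%N ->
  P c x -> P (c * k)%N (x ^+ k).
Proof.
move=> gP cx; case: k => // k _ Px.
by rewrite mulnS exprSr addnC; apply: (gfam_pow gP) => //; apply: ipow_exp.
Qed.

Lemma gprime_separate Ps P : gprime P -> (forall Q, List.In Q Ps -> gprime Q) ->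
  (forall Q, List.In Q Ps -> exists k y, [/\ ipow m k y, Q k y & ~ P k y]) ->
  exists k y, [/\ (0 < k)%N, ipow m k y, ~ P k y & forall Q, List.In Q Ps -> Q k y].
Proof.
move=> prP; elim: Ps => [|Q Ps IH] prPs H.
  case: (prP) => _ _ [a ma nPa]; exists 1%N, a; split=> //; exact: ipow1.
have [||k [y [k0 ky nPy yPs]]] := IH; first by move=> Q' ?; apply: prPs; right.
  by move=> Q' ?; apply: H; right.
have [j [z [jz Qz nPz]]] : exists j z, [/\ ipow m j z, Q j z & ~ P j z] by apply: H; left.
exists (k + j)%N, (y * z); split; [by rewrite addn_gt0 k0|exact: ipow_mul| |].
  by case: (prP) => _ H' _ Pyz; case: (H' _ _ _ _ ky jz Pyz).
move=> Q' [<-|Q'Ps]; first by apply: gfam_pow ky Qz; case: (prPs Q) => //; left.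
rewrite addnC mulrC; apply: gfam_pow jz (yPs _ Q'Ps).
by case: (prPs Q') => //; right.
Qed.

(** A prime contained in the head of the list may be dropped from it, so one may assume that the
    head contains no other prime of the list. The degree [c] is left free because elements can be
    compared only after raising them to powers of equal degree. *)
Lemma graded_prime_avoidance Ps : (forall P, List.In P Ps -> gprime P) ->
  exists c x, [/\ (0 < c)%N, ipow m c x & forall P, List.In P Ps -> ~ P c x].
Proof.
have [n] := ubnP (length Ps); elim: n Ps => // n IH [_ _|P Ps].
  by exists 1%N, 0; split=> //; apply: (@ideal0 _ (ipow m 1)); apply: ipow_ideal.
rewrite ltnS => szPs prPs.
have prP : gprime P by apply: prPs; left.
case: (classic (exists Q, List.In Q Ps /\ forall k y, ipow m k y -> Q k y -> P k y)).
  case=> Q [/(List.in_split Q Ps)[l1 [l2 Ps12]] QP].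
  have [||c [x [c0 cx xPs]]] := IH (P :: l1 ++ l2)%list.
  - by move: szPs; rewrite Ps12 /= !List.length_app /=; clear; lia.
  - move=> P' [<-//|P'l]; apply: prPs; right; rewrite Ps12.
    have /List.in_app_iff : List.In P' (l1 ++ l2)%list by [].
    by rewrite List.in_app_iff /=; tauto.
  exists c, x; split=> // P' [<-|]; first by apply: xPs; left.
  move=> P'Ps; have /List.in_app_iff/= P'l : List.In P' (l1 ++ Q :: l2)%list by rewrite -Ps12.
  have nPx : ~ P c x by apply: xPs; left.
  case: P'l => [P'l|[<- Qx|P'l]]; [|by apply: (nPx); apply: QP|];
    by apply: xPs; right; rewrite List.in_app_iff; tauto.
move=> noQ.
have prPs' Q : List.In Q Ps -> gprime Q by move=> ?; apply: prPs; right.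
have [|k [y [k0 ky nPy yPs]]] := gprime_separate prP prPs'.
  move=> Q QPs; apply: NNPP => H; apply: noQ; exists Q; split=> // k y ky Qy.
  by apply: NNPP => nPy; apply: H; exists k, y.
have [|c [x [c0 cx xPs]]] := IH Ps _ prPs'; first exact: leq_trans szPs.
case: (classic (P c x)) => Px; last first.
  by exists c, x; split=> // Q [<-|/xPs].
(* The remaining case has x in P. The exponents bring x^k and y^c to the common degree c k; modulo P
   only y^c survives, modulo every other prime of the list only x^k. *)
have cxk := ipow_exp k im cx; have kyc := ipow_exp c im ky; rewrite mulnC in kyc.
exists (c * k)%N, (x ^+ k + y ^+ c); split; [by rewrite muln_gt0 c0|exact: idealD (ipow_ideal _ im) _ _|].
move=> Q [<- Pxy|QPs Qxy].
  have [gP _ _] := prP; apply: nPy; apply: (gprime_exp (k := c)) => //.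
  rewrite mulnC -(addKr (x ^+ k) (y ^+ c)) addrC; apply: idealB => //; first by case: gP.
  exact: gfam_exp.
have prQ := prPs' _ QPs; have [gQ _ _] := prQ.
apply: (xPs _ QPs); apply: (gprime_exp (k := k)) => //.
have := gfam_exp gQ ky c0 (yPs _ QPs); rewrite mulnC => Qy.
by rewrite -(addrK (y ^+ c) (x ^+ k)); apply: idealB => //; case: gQ.
Qed.

End GradedPrimes.

(** * Local rings: Nakayama, primes over an ideal, Artin-Rees, and systems of parameters with
    control of initial forms *)

Section LocalDimension.
Local Open Scope ring_scope.
Variable R : comNzRingType.
Hypothesis nR : noetherian R.
Variable m : R -> Prop.
Hypothesis locR : local_with m.
Implicit Types (I J P Q : R -> Prop).

Lemma local_ideal : is_ideal m. Proof. by case: locR => -[[]]. Qed.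
Let im := local_ideal.

Lemma local_not1 : ~ m 1. Proof. by case: locR => -[[]]. Qed.

Lemma proper_sub_local I : Defs.proper_ideal I -> forall x, I x -> m x.
Proof.
move=> pI.
have [|M [pM IM] maxM] := wf_minimal (P := fun A => Defs.proper_ideal A /\ forall x, I x -> A x) (noetherian_wf nR).
  by exists I.
have MM : seteqR M m.
  apply: locR.2.
  split=> // N pN MN x; split; last exact: MN.
  move=> Nx; apply: NNPP => nMx; apply: (maxM N); last by split=> // y /IM/MN.
  by split=> //; [case: pM|case: pN|move=> H; apply/nMx/H].
by move=> x /IM; apply: (MM x).1.
Qed.

Lemma local_unit u : ~ m u -> exists v, v * u = 1.
Proof.
move=> nmu; apply: NNPP => H.
have ia : is_ideal (fun y => exists r, y = r * u).
  split; first by exists 0; rewrite mul0r.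
    by move=> _ _ [r ->] [s ->]; exists (r + s); rewrite mulrDl.
  by move=> t _ [r ->]; exists (t * r); rewrite mulrA.
apply: nmu; apply: (proper_sub_local (I := fun y => exists r, y = r * u)).
  by split=> // -[r e]; apply: H; exists r.
by exists 1; rewrite mul1r.
Qed.

Lemma local_prime : is_prime m.
Proof.
split=> [|a b mab]; first by split; [exact: im|exact: local_not1].
case: (classic (m a)) => [|/local_unit[v va]]; [by left|right].
by rewrite -[b]mul1r -va -mulrA; apply: idealM.
Qed.

(** Take C maximal among the ideals that contain [B] but not [A]. If a y is not in C, with a in m
    and y in [A], then y lies in C + R a y, so (1 - r a) y is in C for some r; since 1 - r a is a
    unit, a y is in C after all. So C contains [B] + m [A], hence [A]. *)
Lemma nakayama A B : is_ideal A -> is_ideal B ->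
  (forall y, A y -> isum B (iprod m A) y) -> forall y, A y -> B y.
Proof.
move=> iA iB AB; apply: NNPP => nAB.
have [|C [iC BC nAC] maxC] := wf_minimal (noetherian_wf nR)
  (P := fun C => [/\ is_ideal C, forall y, B y -> C y & ~ forall y, A y -> C y]).
  by exists B.
have full D : sub_ideal_gt D C -> forall y, A y -> D y.
  move=> DC; apply: NNPP => nAD; apply: (maxC D DC); case: DC => _ iD CD _.
  by split=> // y /BC/CD.
apply: nAC => y /AB; apply: isum_min => // {y} z; apply: iprod_min => // a y ma Ay.
apply: NNPP => nCay.
have [r Cr] := full _ (adjoin_gt iC nCay) y Ay.
have nm : ~ m (1 - r * a).
  move=> m1; apply: local_not1; rewrite -(subrK (r * a) 1).
  by apply: idealD => //; apply: idealM.
have [v vE] := local_unit nm; apply: nCay.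
have -> : a * y = a * v * (y - r * (a * y)).
  by rewrite -[in LHS](mul1r y) -vE; ring.
exact: idealM.
Qed.

(** If a b lies in [I] while a and b do not, the primes over I + (a) and over I + (b) together serve
    for [I], and the exponents add because (I + (a)) (I + (b)) is contained in [I]. The list may
    contain primes that are not minimal. *)
Lemma minimal_primes I : is_ideal I ->
  exists (Ps : list (R -> Prop)) r,
  [/\ forall P, List.In P Ps -> is_prime P /\ forall x, I x -> P x,
      forall Q, is_prime Q -> (forall x, I x -> Q x) ->
        exists2 P, List.In P Ps & forall x, P x -> Q x &
      forall A, is_ideal A -> (forall P, List.In P Ps -> forall x, A x -> P x) ->
        forall x, ipow A r x -> I x].
Proof.
elim/(well_founded_ind (noetherian_wf nR)): I => I IH iI.
case: (classic (I 1)) => I1.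
  exists nil, 0%N; split=> // [Q [[_ nQ1] _] IQ|A _ _ x _].
    by case: nQ1; apply: IQ.
  by rewrite -[x]mulr1; apply: idealM.
case: (classic (forall a b, I (a * b) -> I a \/ I b)) => [prI|].
  exists [:: I]%list, 1%N; split=> [P [<-|//]|Q _ IQ|A iA AI x].
  - by split.
  - by exists I => //; left.
  - by move/(ipow1E iA) => Ax; apply: (AI I) => //; left.
move=> /not_all_ex_not[a] /not_all_ex_not[b] nab.
have [Iab [nIa nIb]] : I (a * b) /\ ~ I a /\ ~ I b by tauto.
have [Ps1 [r1 [pr1 min1 nil1]]] := IH _ (adjoin_gt iI nIa) (adjoin_ideal a iI).
have [Ps2 [r2 [pr2 min2 nil2]]] := IH _ (adjoin_gt iI nIb) (adjoin_ideal b iI).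
exists (Ps1 ++ Ps2)%list, (r1 + r2)%N; split.
- by move=> P /List.in_app_iff[/pr1|/pr2] [prP H]; split=> // x Ix; apply: H; apply: adjoin_sub.
- move=> Q prQ IQ; have [[iQ _] Qab] := prQ.
  have aux c : Q c -> forall x, adjoin I c x -> Q x.
    by move=> Qc x [r /IQ Qx]; apply: idealBr Qx => //; apply: idealM.
  case: (Qab a b (IQ _ Iab)) => /aux H.
    by have [P PPs PQ] := min1 Q prQ H; exists P => //; apply/List.in_app_iff; left.
  by have [P PPs PQ] := min2 Q prQ H; exists P => //; apply/List.in_app_iff; right.
- move=> A iA AP; apply: ipow_min_add => // x y Ax Ay.
  have [r Ir] : adjoin I a x.
    by apply: (nil1 A) => // P PPs; apply: AP; apply/List.in_app_iff; left.
  have [s Is] : adjoin I b y.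
    by apply: (nil2 A) => // P PPs; apply: AP; apply/List.in_app_iff; right.
  have -> : x * y = (x - r * a) * y + r * a * (y - s * b) + r * s * (a * b) by ring.
  apply: idealD => //; last exact: idealM.
  by rewrite [(x - _) * y]mulrC; apply: idealD => //; apply: idealM.
Qed.

(** The Artin-Rees lemma, by iterating [rees_stab] on the constant family [Q]. *)
Lemma rees_stab_pow Q : is_ideal Q -> exists D, forall n k, (D <= n)%N ->
  forall y, ipow m (n + k) y -> Q y ->
  iprod (ipow m k) (fun z => ipow m n z /\ Q z) y.
Proof.
move=> iQ; have gQ : gfam m (fun _ => Q) by split=> // *; apply: idealM.
have [D HD] := rees_stab nR im gQ; exists D => n k Dn.
elim: k => [|k IH] y.
  by rewrite addn0 -[y in iprod _ _ y]mul1r => ny Qy; apply: iprod_mul.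
rewrite addnS => ny Qy; move: (HD (n + k)%N (leq_trans Dn (leq_addr _ _)) y ny Qy).
have ii := iprod_ideal (fun z => ipow m n z /\ Q z) (ipow_ideal k.+1 im).
apply: iprod_min => // a z ma [nz Qz]; have H := IH z nz Qz.
have iq : is_ideal (fun y => iprod (ipow m k.+1) (fun z => ipow m n z /\ Q z) (a * y)).
  split; [by rewrite mulr0; apply: ideal0|by move=> u v; rewrite mulrDr; apply: idealD|].
  by move=> r u; rewrite mulrCA; apply: idealM.
apply: (iprod_min iq _ H) => u v ku nv.
by rewrite mulrA; apply: iprod_mul => //; apply: ipowS_mul.
Qed.

(* x_j has order >= deg j, and the initial forms x_j^* generate an ideal of gr_m(R/I)
   containing everything of degree >= n0. *)
Definition gr_params I d (x : nat -> R) (deg : nat -> nat) n0 :=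
  (forall j, (j < d)%N -> [/\ (0 < deg j)%N, (deg j <= n0)%N & ipow m (deg j) (x j)]) /\
  forall n y, (n0 <= n)%N -> ipow m n y -> exists b : nat -> R,
    (forall j, (j < d)%N -> ipow m (n - deg j) (b j)) /\
    I (y - \sum_(j < d) x j * b j).

Lemma prime_chain_cons I J d (P : nat -> R -> Prop) Q : prime_chain J d P -> is_prime Q ->
  (forall x, I x -> Q x) -> (forall x, Q x -> P 0%N x) -> (exists2 x, P 0%N x & ~ Q x) ->
  (forall x, I x -> J x) -> prime_chain I d.+1 (fun i => if i is i'.+1 then P i' else Q).
Proof.
move=> [H1 H2] prQ IQ QP [x Px nQx] IJ; split=> [[|i] id|[|i] id] //.
- by have [pr JP] := H1 i id; split=> // y /IJ/JP.
- by split=> //; exists x.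
- exact: H2.
Qed.

(** The hypothesis says dim R/I <= d, a form that passes to I + (x) in the induction. For d = 0
    every prime over [I] is m, so a power of m lies in [I]. In the step, the parameters of I + (x)
    leave a remainder in I + (x), which must be written as x b modulo [I] with b of the expected
    order; this is where filter-regularity of the initial form of x enters. *)
Lemma gr_params_exist d I : is_ideal I -> ~ (exists P : nat -> R -> Prop, prime_chain I d.+1 P) ->
  exists x deg n0, gr_params I d x deg n0.
Proof.
elim: d I => [|d IH] I iI nochain; have [Ps [r [prPs minPs nilPs]]] := minimal_primes iI.
  exists (fun=> 0), (fun=> 0%N), r; split=> // n y rn ny; exists (fun=> 0); split=> //.
  rewrite big_ord0 subr0; apply: (nilPs m) => //; last exact: ipow_leq rn ny.
  move=> P PPs; have [prP IP] := prPs P PPs; apply: NNPP => nmP.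
  have Pm : forall x, P x -> m x by apply: proper_sub_local; case: prP.
  apply: nochain; exists (fun i => if i is 0%N then P else m); split=> [[|i] _|[|i] //= _] //.
    by split; [exact: local_prime|move=> x /IP/Pm].
  split=> //; apply: NNPP => H; apply: nmP => x mx.
  by apply: NNPP => nPx; apply: H; exists x.
(* The quotient of the Rees algebra by this homogeneous ideal is gr_m(R/I). *)
have gI : gfam m (fun n => isum (ipow m n.+1) I).
  split=> [n|a n y ma ny]; first exact: powsum_ideal.
  rewrite -(add1n n.+1); apply: powsum_mul => //.
  by apply: isum_l => //; apply: ipow1.
have [Qs [e [prQs HQs]]] := filter_regular_criterion nR im gI.
(* The primes over [I] that do not contain m, viewed as constant families, join the list to be
   avoided; this makes the dimension drop. *)
have [Ns [prNs PsNs]] : exists Ns : list (nat -> R -> Prop), (forall P : nat -> R -> Prop, List.In P Ns -> gprime m P) /\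
    forall P, List.In P Ps -> (exists2 a, m a & ~ P a) -> List.In (fun _ => P) Ns.
  elim: Ps prPs {minPs nilPs} => [|P Ps IHP] prPs; first by exists nil.
  have [|Ns [prNs PsNs]] := IHP; first by move=> Q QPs; apply: prPs; right.
  case: (classic (exists2 a, m a & ~ P a)) => [relP|irrP].
    have [[[iP nP1] prP] IP] : is_prime P /\ forall x, I x -> P x by apply: prPs; left.
    exists ((fun _ => P) :: Ns)%list; split=> [Q [<-|/prNs]//|Q [<-|QPs] relQ]; [|by left|by right; apply: PsNs].
    split=> // [|i j a b _ _ Pab]; last exact: prP.
    by split=> // *; apply: idealM.
  exists Ns; split=> // Q [<- /irrP[]|]; exact: PsNs.
have [|c [x [c0 cx xavoid]]] := graded_prime_avoidance im (Ps := (Qs ++ Ns)%list).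
  by move=> P /List.in_app_iff[/prQs|/prNs].
have iI' : is_ideal (adjoin I x) by apply: adjoin_ideal.
have [|x' [deg' [n0 [H1 H2]]]] := IH _ iI'.
  (* A chain over I + (x) extends downwards: its bottom contains some Q of the list. The bottom is
     strictly below another prime, so it does not contain m, and neither does Q; thus x avoids Q and
     the inclusion is strict. *)
  move=> [P chP]; have [ch1 ch2] := chP.
  have [prP0 IP0] := ch1 0%N isT; have [[iP0 nP01] _] := prP0.
  have [||Q QPs QP] := minPs (P 0%N) => //; first by move=> y Iy; apply: IP0; apply: adjoin_sub.
  have [prQ IQ] := prPs Q QPs.
  have Pm : exists2 a, m a & ~ P 0%N a.
    have [P01 [a [P1a nP0a]]] := ch2 0%N isT; exists a => //.
    have [[pP1 _] _] := ch1 1%N isT.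
    exact: (proper_sub_local pP1).
  have nQx : ~ Q x.
    apply: (xavoid (fun _ => Q)); apply/List.in_app_iff; right; apply: PsNs => //.
    by case: Pm => a ma nPa; exists a => // /QP.
  apply: nochain; exists (fun i => if i is i'.+1 then P i' else Q).
  apply: (prime_chain_cons chP) => //; last by move=> y; apply: adjoin_sub.
  by exists x => //; apply: IP0; apply: adjoin_mem.
have [D HD] := rees_stab_pow iI'.
(* The order of r' modulo [I] is raised one unit at a time. The starting order e is essential, since
   cancellation of x holds only from degree e on. *)
have xreg n r' : ipow m e r' -> (e <= n)%N -> isum (ipow m (c + n)) I (x * r') -> isum (ipow m n) I r'.
  move=> er' en nxr.
  suff H k : (k <= n - e)%N -> isum (ipow m (e + k)) I r' by rewrite -(subnKC en); apply: H.
  elim: k => [|k IHk] kn; first by rewrite addn0; apply: isum_l.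
  have [u [v [ku Iv r'E]]] := IHk (ltnW kn); rewrite addnS.
  have Lu : isum (ipow m (e + k).+1) I u.
    apply: (HQs c x cx) => //; first by move=> P PQs; apply: xavoid; apply/List.in_app_iff; left.
      exact: leq_addr.
    have -> : x * u = x * r' - x * v by rewrite r'E; ring.
    apply: idealB; first exact: powsum_ideal.
      by apply: powsum_leq nxr => //; move: kn; clear; lia.
    by apply: isum_r; [apply: ipow_ideal|apply: idealM].
  by rewrite r'E; apply: idealD => //; [apply: powsum_ideal|apply: isum_r => //; apply: ipow_ideal].
(* Artin-Rees splits off a factor a in m^e from y. If the other factor is t x modulo [I], then a t
   has order at least e, and [xreg] applies to it. *)
have AR n y : (D + e + c <= n)%N -> ipow m n y -> adjoin I x y ->
    exists2 b, ipow m (n - c) b & I (y - x * b).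
  move=> Dn ny Iy.
  have iq : is_ideal (fun y => exists2 b, ipow m (n - c) b & I (y - x * b)).
    have ii := ipow_ideal (n - c) im; split.
    - by exists 0; rewrite ?mulr0 ?subr0; apply: ideal0.
    - move=> u v [a na Ia] [b nb Ib]; exists (a + b); first exact: idealD.
      by rewrite mulrDr opprD addrACA; apply: idealD.
    - move=> t u [a na Ia]; exists (t * a); first exact: idealM.
      by rewrite mulrCA -mulrBr; apply: idealM.
  have eN : n = (n - e + e)%N by rewrite subnK //; move: Dn; clear; lia.
  rewrite eN in ny; move: (HD (n - e)%N e ltac:(move: Dn; clear; lia) y ny Iy).
  apply: (iprod_min iq) => a q ea [nq [t It]].
  have [|||u [v [nu Iv atE]]] := xreg (n - c)%N (a * t); first exact: idealMR _ (ipow_ideal _ im) ea.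
  - by move: Dn; clear; lia.
  - rewrite subnKC; last by move: Dn; clear; lia.
    have -> : x * (a * t) = a * q - a * (q - t * x) by ring.
    apply: idealB; first exact: powsum_ideal.
      by apply: isum_l => //; rewrite [n in ipow m n]eN addnC; apply: ipow_mul.
    by apply: isum_r; [apply: ipow_ideal|apply: idealM].
  exists u => //.
  have -> : a * q - x * u = a * (q - t * x) + x * v.
    have -> : v = a * t - u by rewrite atE addrC addKr.
    ring.
  by apply: idealD => //; apply: idealM.
exists (fun j => if (j < d)%N then x' j else x), (fun j => if (j < d)%N then deg' j else c).
exists (maxn n0 (D + e + c)%N); split=> [j jd|n y].
  case: ifP => [/H1[? deg0 ?]|_]; last by split=> //; rewrite leq_max (leq_addl (D + e)%N) orbT.
  by split=> //; rewrite leq_max deg0.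
rewrite geq_max => /andP[n0n Dn] ny.
have [b' [nb' Ib']] := H2 n y n0n ny.
have [|//|b nb Ib] := AR n (y - \sum_(j < d) x' j * b' j) Dn.
  apply: idealB => //; first exact: ipow_ideal.
  apply: ideal_sum => [|[j jd] _ /=]; first exact: ipow_ideal.
  have [_ degn x'j] := H1 j jd.
  by rewrite -(subnKC (leq_trans degn n0n)); apply: ipow_mul => //; apply: nb'.
exists (fun j => if (j < d)%N then b' j else b); split=> [j _|].
  by case: ifP => // /nb'.
rewrite big_ord_recr /= ltnn.
have -> : \sum_(i < d) (if (i < d)%N then x' i else x) * (if (i < d)%N then b' i else b) =
    \sum_(j < d) x' j * b' j by apply: eq_bigr => i _; rewrite ltn_ord.
by rewrite opprD addrA.
Qed.

End LocalDimension.

(* The Koszul complex on x_0, ..., x_(d-1), as the iterated mapping cone: (a, b) stands for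
   a + b e_(d-1), and e_j carries weight deg j. *)
Section KoszulComplex.
Local Open Scope ring_scope.

Fixpoint koszul (S : comNzRingType) d : lmodType S :=
  if d is d'.+1 then (koszul S d' * koszul S d')%type : lmodType S else S^o.

Variable S : comNzRingType.
Variable x : nat -> S.
Variable deg : nat -> nat.

Fixpoint bd d : koszul S d -> koszul S d :=
  match d return koszul S d -> koszul S d with
  | 0 => fun _ => 0
  | d'.+1 => fun z => (bd z.1 + x d' *: z.2, - bd z.2)
  end.

(** Exterior multiplication by e_j, with the signs that make it a homotopy from multiplication by
    x_j to zero ([bd_homot]). *)
Fixpoint homot j d : koszul S d -> koszul S d :=
  match d return koszul S d -> koszul S d with
  | 0 => fun _ => 0
  | d'.+1 => fun z => if j == d' then (0, z.1) else (homot j z.1, - homot j z.2)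
  end.

Lemma bdP d a (u v : koszul S d) : bd (a *: u + v) = a *: bd u + bd v.
Proof.
elim: d u v => [|d IH] u v /=; first by rewrite scaler0 addr0.
congr pair; rewrite IH /=.
  by rewrite !scalerDr !scalerA [x d * a]mulrC addrACA.
by rewrite opprD -scalerN.
Qed.

Lemma homotP j d a (u v : koszul S d) : homot j (a *: u + v) = a *: homot j u + homot j v.
Proof.
elim: d u v => [|d IH] u v /=; first by rewrite scaler0 addr0.
case: eqP => _; congr pair => /=; first by rewrite scaler0 addr0.
  exact: IH.
by rewrite IH opprD -scalerN.
Qed.

Lemma homot0 j d : homot j (0 : koszul S d) = 0.
Proof. by have := homotP j (-1) (0 : koszul S d) 0; rewrite scaler0 addr0 scaleN1r addNr. Qed.
Lemma homotD j d (u v : koszul S d) : homot j (u + v) = homot j u + homot j v.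
Proof. by rewrite -[u]scale1r homotP !scale1r. Qed.
Lemma homotZ j d a (u : koszul S d) : homot j (a *: u) = a *: homot j u.
Proof. by rewrite -[_ *: u]addr0 homotP homot0 addr0. Qed.
Lemma homotN j d (u : koszul S d) : homot j (- u) = - homot j u.
Proof. by rewrite -scaleN1r homotZ scaleN1r. Qed.

Lemma bd0 d : bd (0 : koszul S d) = 0.
Proof. by have := bdP (-1) (0 : koszul S d) 0; rewrite scaler0 addr0 scaleN1r addNr. Qed.
Lemma bdD d (u v : koszul S d) : bd (u + v) = bd u + bd v.
Proof. by rewrite -[u]scale1r bdP !scale1r. Qed.
Lemma bdZ d a (u : koszul S d) : bd (a *: u) = a *: bd u.
Proof. by rewrite -[_ *: u]addr0 bdP bd0 addr0. Qed.
Lemma bdN d (u : koszul S d) : bd (- u) = - bd u.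
Proof. by rewrite -scaleN1r bdZ scaleN1r. Qed.
Lemma bdB d (u v : koszul S d) : bd (u - v) = bd u - bd v.
Proof. by rewrite bdD bdN. Qed.
Lemma bd_sum d (T : Type) (s : seq T) (f : T -> koszul S d) :
  bd (\sum_(i <- s) f i) = \sum_(i <- s) bd (f i).
Proof. by apply: (big_morph (@bd d) (@bdD d)); apply: bd0. Qed.

Lemma bd_bd d (z : koszul S d) : bd (bd z) = 0.
Proof.
elim: d z => [|d IH] z //=.
by congr pair; rewrite ?bdN ?bdD ?IH ?bdZ ?oppr0 // add0r scalerN subrr.
Qed.

Lemma bd_homot j d (z : koszul S d) : (j < d)%N ->
  bd (homot j z) + homot j (bd z) = x j *: z.
Proof.
elim: d z => // d IH z; rewrite ltnS leq_eqVlt /=.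
case: eqP => [-> _|_ /= jd] /=.
  by rewrite bd0 add0r; congr pair; rewrite /= ?addr0 // addrA addNr add0r.
rewrite bdN !homotN !opprK scalerN homotD homotZ.
by congr pair => /=; rewrite ?IH // addrACA IH // addNr addr0.
Qed.

Fixpoint kincl d (y : S) : koszul S d :=
  match d return koszul S d with 0 => y | d'.+1 => (kincl d' y, 0) end.

Fixpoint kbot d : koszul S d -> S :=
  match d return koszul S d -> S with 0 => fun z => z | d'.+1 => fun z => kbot z.1 end.

Lemma kinclP d a y z : kincl d (a * y + z) = a *: kincl d y + kincl d z.
Proof. by elim: d => //= d ->; congr pair => /=; rewrite scaler0 addr0. Qed.
Lemma kincl0 d : kincl d 0 = 0. Proof. by elim: d => //= d ->. Qed.
Lemma kincl_sum d n (a y : nat -> S) :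
  kincl d (\sum_(j < n) a j * y j) = \sum_(j < n) a j *: kincl d (y j).
Proof.
elim: n => [|n IH]; first by rewrite !big_ord0 kincl0.
by rewrite !big_ord_recr /= addrC kinclP IH addrC.
Qed.
Lemma bd_kincl d y : bd (kincl d y) = 0.
Proof. by elim: d => //= d ->; rewrite scaler0 addr0 bd0 oppr0. Qed.

(* kall F z: every component of z of homological degree i and weight w satisfies F i w. *)
Fixpoint kall d (F : nat -> nat -> S -> Prop) : koszul S d -> Prop :=
  match d return koszul S d -> Prop with
  | 0 => fun z => F 0 0 z
  | d'.+1 => fun z => kall F z.1 /\ kall (fun i w => F i.+1 (w + deg d')%N) z.2
  end.

Lemma kall_mono d F G (z : koszul S d) :
  (forall i w y, F i w y -> G i w y) -> kall F z -> kall G z.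
Proof.
elim: d F G z => [|d IH] F G z FG /=; first exact: FG.
by case=> Fz Fz'; split; [apply: IH Fz|apply: IH Fz' => i w y; apply: FG].
Qed.

Lemma kall_all d F (z : koszul S d) : (forall i w y, F i w y) -> kall F z.
Proof. by elim: d F z => [|d IH] F z H //=; split; apply: IH. Qed.

Lemma kall_and d F G (z : koszul S d) : kall F z -> kall G z ->
  kall (fun i w y => F i w y /\ G i w y) z.
Proof.
elim: d F G z => [|d IH] F G z /=; first by split.
by move=> [? ?] [? ?]; split; apply: IH.
Qed.

Lemma kall0 d F : (forall i w, F i w 0) -> kall F (0 : koszul S d).
Proof. by elim: d F => [|d IH] F H /=; [exact: H|split; apply: IH => *; apply: H]. Qed.

Lemma kallD d F G H (u v : koszul S d) :
  (forall i w y z, F i w y -> G i w z -> H i w (y + z)) ->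
  kall F u -> kall G v -> kall H (u + v).
Proof.
elim: d F G H u v => [|d IH] F G H u v FGH /=; first exact: FGH.
move=> [Fu Fu'] [Gv Gv']; split; first exact: IH FGH Fu Gv.
by apply: IH Fu' Gv' => i w y z; apply: FGH.
Qed.

Lemma kallZ d F G a (z : koszul S d) : (forall i w y, F i w y -> G i w (a * y)) ->
  kall F z -> kall G (a *: z).
Proof.
elim: d F G z => [|d IH] F G z FG /=; first exact: FG.
case=> Fz Fz'; split; first exact: IH FG Fz.
by apply: IH Fz' => i w y; apply: FG.
Qed.

Lemma kallN d F G (z : koszul S d) : (forall i w y, F i w y -> G i w (- y)) ->
  kall F z -> kall G (- z).
Proof. by move=> FG; rewrite -scaleN1r; apply: kallZ => i w y; rewrite mulN1r; apply: FG. Qed.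

Definition kideal (F : nat -> nat -> S -> Prop) := forall i w, is_ideal (F i w).

Definition kadd (F : nat -> nat -> S -> Prop) :=
  [/\ forall i w, F i w 0, forall i w y, F i w y -> F i w (- y) &
      forall i w y z, F i w y -> F i w z -> F i w (y + z)].

Lemma kaddD d F (u v : koszul S d) : kadd F -> kall F u -> kall F v -> kall F (u + v).
Proof. by case=> _ _ FD; apply: kallD. Qed.
Lemma kaddN d F (u : koszul S d) : kadd F -> kall F u -> kall F (- u).
Proof. by case=> _ FN _; apply: kallN. Qed.
Lemma kaddB d F (u v : koszul S d) : kadd F -> kall F u -> kall F v -> kall F (u - v).
Proof. by move=> aF Fu Fv; apply: kaddD => //; apply: kaddN. Qed.
Lemma kadd_sum d F n (f : nat -> koszul S d) : kadd F ->
  (forall j, (j < n)%N -> kall F (f j)) -> kall F (\sum_(j < n) f j).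
Proof.
move=> aF Ff; apply: (big_ind (@kall d F)) => [|u v|[j jn] _]; last exact: Ff.
  by apply: kall0; case: aF.
exact: kaddD.
Qed.

Lemma kideal_kadd F : kideal F -> kadd F.
Proof. by move=> iF; split=> *; [apply: ideal0|apply: idealN|apply: idealD]. Qed.

Lemma kadd_shift F w0 : kadd F -> kadd (fun i w => F i.+1 (w + w0)%N).
Proof. by case=> F0 FN FD; split=> *; [apply: F0|apply: FN|apply: FD]. Qed.

Lemma kall_bd d F G (z : koszul S d) : kadd G ->
  (forall i w j y, (j < d)%N -> F i.+1 (w + deg j)%N y -> G i w (x j * y)) ->
  kall F z -> kall G (bd z).
Proof.
elim: d F G z => [|d IH] F G z aG FG /=; first by move=> _; case: aG.
case=> Fz Fz'; split.
  apply: kaddD => //; first by apply: IH Fz => // i w j y jd; apply: FG; apply: ltnW.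
  by apply: kallZ Fz' => i w y; apply: FG.
apply: kaddN; first exact: kadd_shift.
apply: IH Fz'; first exact: kadd_shift.
by move=> i w j y jd; rewrite addnAC; apply: FG; apply: ltnW.
Qed.

Lemma kall_homot j d F G (z : koszul S d) : kadd G ->
  (forall i w y, F i w y -> G i.+1 (w + deg j)%N y) -> kall F z -> kall G (homot j z).
Proof.
elim: d F G z => [|d IH] F G z aG FG /=; first by move=> _; case: aG.
case=> Fz Fz'; case: eqP FG => [->|_] FG; split.
- by apply: kall0; case: aG.
- exact: kall_mono Fz.
- exact: IH Fz.
- apply: kaddN; first exact: kadd_shift.
  apply: IH Fz'; first exact: kadd_shift.
  by move=> i w y; rewrite addnAC; apply: FG.
Qed.

Lemma kall_ex d g (F F1 F2 : nat -> nat -> S -> Prop) (z : koszul S d) :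
  (forall i w y, F i w y -> exists2 u, F1 i w u & F2 i w (y - g * u)) ->
  kall F z -> exists2 u, kall F1 u & kall F2 (z - g *: u).
Proof.
elim: d F F1 F2 z => [|d IH] F F1 F2 z H /=; first exact: H.
case=> Fz Fz'; have [u Fu Gu] := IH _ _ _ _ H Fz.
have [v Fv Gv] := IH _ _ (fun i w => F2 i.+1 (w + deg d)%N) _ (fun i w => H i.+1 (w + deg d)%N) Fz'.
by exists (u, v).
Qed.

Lemma kall_vanish d t (z : koszul S d) : (d < t)%N ->
  kall (fun i _ y => (i < t)%N -> y = 0) z -> z = 0.
Proof.
elim: d t z => [|d IH] t z dt /=; first exact.
case: z => u v /= [/IH Fu Fv]; congr pair; first by apply: Fu; apply: ltnW.
apply: (IH t.-1); first by move: dt; clear; lia.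
by apply: kall_mono Fv => i _ y H it; apply: H; move: it; clear; lia.
Qed.

Lemma kall_bot d F (z : koszul S d) : kall F z -> F 0%N 0%N (kbot z).
Proof. by elim: d F z => [|d IH] F z //= [/IH]. Qed.

Lemma kall_incl d F y : (forall i w, F i w 0) -> F 0%N 0%N y -> kall F (kincl d y).
Proof.
elim: d F => [|d IH] F F0 Fy //=; split; first exact: IH.
by apply: kall0 => i w; apply: F0.
Qed.

Lemma kall_sub_bot d (z : koszul S d) :
  kall (fun i _ y => (i < 1)%N -> y = 0) (z - kincl d (kbot z)).
Proof.
elim: d z => [|d IH] z /=; first by rewrite subrr.
by split; [apply: IH|apply: kall_all].
Qed.

End KoszulComplex.

Lemma kall_reg (S : comNzRingType) deg d g F G H (z : koszul S d) :
  (forall i w y, F i w y -> G i w (g * y)%R -> H i w y) ->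
  kall deg F z -> kall deg G (g *: z)%R -> kall deg H z.
Proof.
elim: d F G H z => [|d IH] F G H z FGH /=; first exact: FGH.
case=> Fz Fz' [Gz Gz']; split; first exact: IH FGH Fz Gz.
by apply: IH Fz' Gz' => i w y; apply: FGH.
Qed.

Section KoszulMap.
Local Open Scope ring_scope.
Variables (S S' : comNzRingType) (deg : nat -> nat).

(** The map may depend on homological degree and weight: this serves to pass between R and R[T] with
    weight-dependent powers of T, and to project onto the components of one parity. *)
Fixpoint kmap d (f : nat -> nat -> S -> S') : koszul S d -> koszul S' d :=
  match d return koszul S d -> koszul S' d with
  | 0 => fun z => f 0 0 z
  | d'.+1 => fun z => (kmap f z.1, kmap (fun i w => f i.+1 (w + deg d')%N) z.2)
  end.

Lemma kmapD d f (u v : koszul S d) : (forall i w, {morph f i w : y z / y + z}) ->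
  kmap f (u + v) = kmap f u + kmap f v.
Proof.
elim: d f u v => [|d IH] f u v fD /=; first exact: fD.
by rewrite !IH // => i w; apply: fD.
Qed.

Lemma kmapN d f (u : koszul S d) : (forall i w, {morph f i w : y / - y}) ->
  kmap f (- u) = - kmap f u.
Proof.
elim: d f u => [|d IH] f u fN /=; first exact: fN.
by rewrite !IH // => i w; apply: fN.
Qed.

Lemma kmapB d f (u v : koszul S d) : (forall i w, {morph f i w : y z / y + z}) ->
  (forall i w, {morph f i w : y / - y}) -> kmap f (u - v) = kmap f u - kmap f v.
Proof. by move=> fD fN; rewrite kmapD // kmapN. Qed.

Lemma kall_kmap d f F G (z : koszul S d) : (forall i w y, F i w y -> G i w (f i w y)) ->
  kall deg F z -> kall deg G (kmap f z).
Proof.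
elim: d f F G z => [|d IH] f F G z FG /=; first exact: FG.
by case=> ? ?; split; [apply: IH FG _|apply: (IH _ (fun i w => F i.+1 (w + deg d)%N)) => // i w y; apply: FG].
Qed.

Lemma kmap_scale d c c' f f' G (z : koszul S d) :
  (forall i w y, G i w (f i w (c * y) - c' * f' i w y)) ->
  kall deg G (kmap f (c *: z) - c' *: kmap f' z).
Proof.
elim: d f f' G z => [|d IH] f f' G z H /=; first exact: H.
by split; apply: IH => i w y; apply: H.
Qed.

(** Only the generators have to be compared: a basis element e_j raises the degree by 1 and the
    weight by [deg j], which fixes the indices at which [f] and [f'] are evaluated. *)
Lemma kmap_bd d x x' f f' G (z : koszul S d) : kadd G ->
  (forall i w, {morph f i w : y z / y + z}) -> (forall i w, {morph f i w : y / - y}) ->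
  (forall i w j y, (j < d)%N -> G i w (f i w (x j * y) - x' j * f' i.+1 (w + deg j)%N y)) ->
  kall deg G (kmap f (bd x z) - bd x' (kmap f' z)).
Proof.
elim: d f f' G z => [|d IH] f f' G z aG fD fN H /=.
  have f0 : f 0%N 0%N 0 = 0 by apply: (addIr (f 0%N 0%N 0)); rewrite -fD !add0r.
  by rewrite f0 subrr; case: aG.
split.
  rewrite kmapD // opprD addrACA; apply: kaddD => //.
    by apply: IH => // i w j y jd; apply: H; apply: ltnW.
  by apply: kmap_scale => i w y; apply: H.
rewrite kmapN => [|i w]; last exact: fN.
rewrite -opprD; apply: kaddN; first exact: kadd_shift.
apply: IH => [|i w|i w|i w j y jd]; [exact: kadd_shift|exact: fD|exact: fN|].
by rewrite addnAC; apply: H; apply: ltnW.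
Qed.

End KoszulMap.

Lemma kmap_kmap (S1 S2 S3 : comNzRingType) deg d f g (z : koszul S1 d) :
  kmap deg g (kmap deg f z : koszul S2 d) = kmap deg (fun i w y => g i w (f i w y)) z :> koszul S3 d.
Proof. by elim: d f g z => //= d IH f g z; rewrite !IH. Qed.

Lemma kall_sub_kmap (S : comNzRingType) deg d f F G (z : koszul S d) :
  (forall i w y, F i w y -> G i w (y - f i w y)%R) ->
  kall deg F z -> kall deg G (z - kmap deg f z)%R.
Proof.
elim: d f F G z => [|d IH] f F G z FG /=; first exact: FG.
case=> Fz Fz'; split; first exact: IH FG Fz.
by apply: IH Fz' => i w y; apply: FG.
Qed.

(** * Depth sensitivity of the Koszul complex *)

Section DepthSensitivity.
Local Open Scope ring_scope.
Variable S : comNzRingType.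
Variables (x : nat -> S) (d : nat) (deg : nat -> nat).
Implicit Types (W L : S -> Prop).

(** The subset [W] acts as ring of scalars because the denominator of gr_m(R/J) is stable under the
    numerator, but not in general under all of R[T]. *)
Definition wmod W L := [/\ L 0, forall a, L a -> L (- a),
  forall a b, L a -> L b -> L (a + b) & forall a b, W a -> L b -> L (a * b)].

Lemma wmod_kadd W L : wmod W L -> kadd (fun _ _ => L).
Proof. by case. Qed.

Definition zero_below t := fun (i : nat) (_ : nat) (y : S) => (i < t)%N -> y = 0.

Lemma zero_below_kadd t : kadd (zero_below t).
Proof.
split=> [i w|i w y H it|i w y z H H' it] //; first by rewrite H // oppr0.
by rewrite H // H' // addr0.
Qed.

(* H_i(x; W/L) = 0 for all i >= t, where W is a subring and L an ideal of W. *)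
Definition kvanish W L t := forall z : koszul S d,
  kall deg (fun _ _ => W) z -> kall deg (zero_below t) z -> kall deg (fun _ _ => L) (bd x z) ->
  exists w, [/\ kall deg (fun _ _ => W) w, kall deg (zero_below t.+1) w &
    kall deg (fun _ _ => L) (z - bd x w)].

Lemma kvanish_large W L t : wmod W W -> wmod W L -> (d < t)%N -> kvanish W L t.
Proof.
move=> [W0 _ _ _] [L0 _ _ _] dt z _ /(kall_vanish dt)-> _; exists 0; split; try exact: kall0.
by rewrite bd0 subr0; apply: kall0.
Qed.

Lemma zero_below_bd t (z : koszul S d) : kall deg (zero_below t.+1) z -> kall deg (zero_below t) (bd x z).
Proof.
apply: kall_bd; first exact: zero_below_kadd.
by move=> i w j y _ H it; rewrite H // mulr0.
Qed.

Lemma zero_below_homot t j (z : koszul S d) :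
  kall deg (zero_below t) z -> kall deg (zero_below t.+1) (homot j z).
Proof. by apply: kall_homot; first exact: zero_below_kadd. Qed.

Section Step.
Variables (W L L' : S -> Prop) (g : S) (t : nat).
Hypotheses (wW : wmod W W) (wL : wmod W L) (wL' : wmod W L').
Hypotheses (Wx : forall j, (j < d)%N -> W (x j)) (Wg : W g).
Hypothesis L'E : forall y, L' y <-> exists2 s, W s & L (y - g * s).
Hypothesis regg : forall y, W y -> L (g * y) -> L y.
Hypothesis vanL' : kvanish W L' t.+1.

Lemma wmod_bd L0 (z : koszul S d) : wmod W L0 -> kall deg (fun _ _ => L0) z ->
  kall deg (fun _ _ => L0) (bd x z).
Proof.
move=> wL0; apply: kall_bd; first exact: wmod_kadd wL0.
by case: wL0 => _ _ _ H i w j y /Wx Wxj; apply: H.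
Qed.

Lemma wmod_homot L0 j (z : koszul S d) : wmod W L0 -> kall deg (fun _ _ => L0) z ->
  kall deg (fun _ _ => L0) (homot j z).
Proof. by move=> wL0; apply: kall_homot => //; apply: wmod_kadd wL0. Qed.

(** The long exact sequence for multiplication by g on W/L, done by hand. If g z = bd w modulo [L],
    then w is a cycle modulo [L'] = L + g W, so w = bd v + g u modulo [L]; hence g (z - bd u) lies
    in [L] and g cancels. *)
Lemma kvanish_cancel (z w : koszul S d) :
  kall deg (fun _ _ => W) z -> kall deg (zero_below t) z ->
  kall deg (fun _ _ => W) w -> kall deg (zero_below t.+1) w ->
  kall deg (fun _ _ => L) (g *: z - bd x w) ->
  exists w', [/\ kall deg (fun _ _ => W) w', kall deg (zero_below t.+1) w' &
    kall deg (fun _ _ => L) (z - bd x w')].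
Proof.
move=> Wz tz Ww tw gzw.
have [W0 WN WD WM] := wW; have [L0 LN LD WL] := wL.
have aL := wmod_kadd wL; have aL' := wmod_kadd wL'.
have LL' y : L y -> L' y by move=> Ly; apply/L'E; exists 0; rewrite ?mulr0 ?subr0.
have gL' y : W y -> L' (g * y) by move=> Wy; apply/L'E; exists y; rewrite ?subrr.
have bdw : kall deg (fun _ _ => L') (bd x w).
  rewrite -[bd x w](subKr (g *: z)); apply: kaddB => //; last first.
    by apply: kall_mono gzw => i w' y; apply: LL'.
  by apply: kallZ Wz => i w' y; apply: gL'.
have [v [Wv tv wv]] := vanL' Ww tw bdw.
have tbv := zero_below_bd tv.
(* The quotient u has to start in degree t + 1 as well: w - bd v vanishes below, so 0 is chosen
   there. *)
have [u Wu guv] : exists2 u, kall deg (fun i w y => W y /\ zero_below t.+1 i w y) u &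
    kall deg (fun _ _ => L) (w - bd x v - g *: u).
  have H := kall_and wv (kaddB (zero_below_kadd _) tw tbv).
  apply: kall_ex H => i w' y [/L'E[s Ws Ls] ty].
  have [it|it] := ltnP i t.+1; last by exists s => //; split=> // /(leq_trans it); rewrite ltnn.
  by exists 0; [split|rewrite ty // mulr0 subr0].
have [Wu' tu] : kall deg (fun _ _ => W) u /\ kall deg (zero_below t.+1) u.
  by split; apply: kall_mono Wu => i w' y [].
exists u; split=> //.
have Wzu : kall deg (fun _ _ => W) (z - bd x u).
  by apply: kaddB (wmod_kadd wW) Wz _; apply: wmod_bd.
have Lgzu : kall deg (fun _ _ => L) (g *: (z - bd x u)).
  have -> : g *: (z - bd x u) = (g *: z - bd x w) + bd x (w - bd x v - g *: u).
    by rewrite !bdB bd_bd subr0 bdZ scalerBr addrA subrK.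
  by apply: kaddD => //; apply: wmod_bd.
apply: kall_reg Wzu Lgzu => i w' y; exact: regg.
Qed.

(* g acts nilpotently on the homology, since a power of g lies in (x) + L, and injectively by
   [kvanish_cancel]. *)
Lemma kvanish_step k (b : nat -> S) : (forall j, (j < d)%N -> W (b j)) ->
  L (g ^+ k - \sum_(j < d) x j * b j) -> kvanish W L t.
Proof.
move=> Wb Lg z Wz tz Lz.
have [W0 WN WD WM] := wW; have [L0 LN LD WL] := wL.
have descend n (w : koszul S d) :
    kall deg (fun _ _ => W) w -> kall deg (zero_below t.+1) w ->
    kall deg (fun _ _ => L) (g ^+ n *: z - bd x w) ->
    exists w', [/\ kall deg (fun _ _ => W) w', kall deg (zero_below t.+1) w' &
      kall deg (fun _ _ => L) (z - bd x w')].
  elim: n w => [|n IH] w Ww tw; first by rewrite scale1r; exists w.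
  rewrite exprS -scalerA => gw.
  have [||w' [Ww' tw' Lw']] := kvanish_cancel (z := g ^+ n *: z) _ _ Ww tw gw.
  - apply: kallZ Wz => _ _ y Wy; elim: (n) => [|l IHl]; first by rewrite mul1r.
    by rewrite exprS -mulrA; apply: WM.
  - by apply: kallZ tz => i w0 y ty it; rewrite ty // mulr0.
  exact: IH Lw'.
have aW := wmod_kadd wW; have aL := wmod_kadd wL.
have bz j : (j < d)%N -> kall deg (fun _ _ => W) (b j *: z).
  by move=> /Wb Wbj; apply: kallZ Wz => _ _ y; apply: WM.
(* Modulo [L], g^k z is the sum of the x_j b_j z, and each x_j acts by zero up to the homotopy
   [homot j]. *)
apply: (descend k (\sum_(j < d) homot j (b j *: z))).
- apply: (kadd_sum (f := fun j => homot j (b j *: z))) => // j jd; apply: wmod_homot => //.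
  exact: bz.
- apply: (kadd_sum (f := fun j => homot j (b j *: z))) => [|j jd]; first exact: zero_below_kadd.
  by apply: zero_below_homot; apply: kallZ tz => i w0 y ty it; rewrite ty // mulr0.
have -> : g ^+ k *: z - bd x (\sum_(j < d) homot j (b j *: z)) =
    (g ^+ k - \sum_(j < d) x j * b j) *: z + \sum_(j < d) homot j (bd x (b j *: z)).
  rewrite bd_sum scalerBl -addrA; congr (_ + _).
  rewrite scaler_suml -!sumrN -big_split /=; apply: eq_bigr => j _.
  by rewrite -scalerA -(bd_homot x (b j *: z) (ltn_ord j)) opprD subrK.
apply: kaddD => //.
  by apply: kallZ Wz => _ _ y Wy; rewrite mulrC; apply: WL.
apply: (kadd_sum (f := fun j => homot j (bd x (b j *: z)))) => // j jd.
apply: wmod_homot => //; rewrite bdZ.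
by apply: kallZ Lz => _ _ y; apply: WL; apply: Wb.
Qed.
End Step.
End DepthSensitivity.

Section RegularSequences.
Local Open Scope ring_scope.
Variable S : comNzRingType.
Implicit Types (W L : S -> Prop).

Definition glin W L (g : nat -> S) i y := exists s : nat -> S,
  (forall k, (k < i)%N -> W (s k)) /\ L (y - \sum_(k < i) s k * g k).

Lemma glin0 W L g y : glin W L g 0 y <-> L y.
Proof.
split=> [[s []]|Ly]; first by rewrite big_ord0 subr0.
by exists (fun=> 0); rewrite big_ord0 subr0.
Qed.

Lemma glinS W L g i y : glin W L g i.+1 y <-> exists2 s, W s & glin W L g i (y - g i * s).
Proof.
split=> [[s [Ws]]|[s Ws [s' [Ws' Ls']]]].
  rewrite big_ord_recr /= => Ls; exists (s i); first exact: Ws.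
  exists s; split; first by move=> k ki; apply: Ws; apply: ltnW.
  by rewrite mulrC -addrA -opprD [s i * _ + _]addrC.
exists (fun k => if (k < i)%N then s' k else s); split.
  by move=> k _; case: ifP => // /Ws'.
rewrite big_ord_recr /= ltnn [s * _]mulrC [_ + g i * s]addrC opprD addrA.
by rewrite (eq_bigr (fun k : 'I_i => s' k * g k)) // => k _; rewrite ltn_ord.
Qed.

Lemma glin_wmod W L g i : wmod W W -> wmod W L -> wmod W (glin W L g i).
Proof.
move=> [W0 WN WD WM] [L0 LN LD WL]; split.
- exists (fun=> 0); split=> //.
  by rewrite big1 ?subr0 // => k _; rewrite mul0r.
- move=> a [s [Ws Ls]]; exists (fun k => - s k); split; first by move=> k /Ws/WN.
  rewrite (eq_bigr (fun k : 'I_i => - (s k * g k))) => [|k _]; last by rewrite mulNr.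
  by rewrite sumrN -opprD; apply: LN.
- move=> a b [s [Ws Ls]] [s' [Ws' Ls']]; exists (fun k => s k + s' k); split.
    by move=> k ki; apply: WD; [apply: Ws|apply: Ws'].
  rewrite (eq_bigr (fun k : 'I_i => s k * g k + s' k * g k)) => [|k _]; last by rewrite mulrDl.
  by rewrite big_split opprD addrACA; apply: LD.
- move=> a b Wa [s [Ws Ls]]; exists (fun k => a * s k); split; first by move=> k /Ws; apply: WM.
  rewrite (eq_bigr (fun k : 'I_i => a * (s k * g k))) => [|k _]; last by rewrite mulrA.
  by rewrite -mulr_sumr -mulrBr; apply: WL.
Qed.

Lemma glin_sub W L g i y : wmod W W -> L y -> glin W L g i y.
Proof.
move=> [W0 _ _ _] Ly; exists (fun=> 0); split=> //.
by rewrite big1 ?subr0 // => k _; rewrite mul0r.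
Qed.

(** Descending induction on l, the number of g's divided out: H_i(x; W/(L + (g_0, ..., g_(l-1)))) =
    0 for i >= t + l. At l = k this range lies above d, where the complex is zero. The g's need only
    be regular and nilpotent modulo (x) + L. *)
Lemma kvanish_depth (x : nat -> S) d deg W L g k t : wmod W W -> wmod W L ->
  (forall j, (j < d)%N -> W (x j)) -> (forall i, (i < k)%N -> W (g i)) ->
  (forall i y, (i < k)%N -> W y -> glin W L g i (g i * y) -> glin W L g i y) ->
  (forall i, (i < k)%N -> exists e (b : nat -> S), (forall j, (j < d)%N -> W (b j)) /\
     L (g i ^+ e - \sum_(j < d) x j * b j)) ->
  (d < t + k)%N -> kvanish x d deg W L t.
Proof.
move=> wW wL Wx Wg reg nil dtk.
have H n : (n <= k)%N -> kvanish x d deg W (glin W L g (k - n)%N) (t + (k - n))%N.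
  elim: n => [|n IH] nk.
    by rewrite subn0; apply: kvanish_large => //; apply: glin_wmod.
  have kn : (k - n.+1 < k)%N by move: nk; clear; lia.
  have [e [b [Wb Lb]]] := nil _ kn.
  have glW l := glin_wmod g l wW wL.
  apply: (kvanish_step wW (glW _) (glW (k - n)%N) Wx (Wg _ kn) _ _ _ Wb).
  - by rewrite -(subnSK nk); apply: glinS.
  - by move=> y; apply: reg.
  - by rewrite -addnS (subnSK nk); apply: IH; apply: ltnW.
  - exact: glin_sub wW Lb.
move=> z Wz tz Lz.
have := H k (leqnn k); rewrite subnn addn0 => /(_ z Wz tz)[].
  by apply: kall_mono Lz => i w y Ly; apply/glin0.
move=> w [Ww tw Lw]; exists w; split=> //.
by apply: kall_mono Lw => i w' y /glin0.
Qed.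

End RegularSequences.

(** * Vanishing of Koszul homology for R/J and for its associated graded ring *)

Section KoszulVanishing.
Local Open Scope ring_scope.
Variable R : comNzRingType.
Variables m J : R -> Prop.
Hypotheses (im : is_ideal m) (iJ : is_ideal J).
Variables (d : nat) (x : nat -> R) (deg : nat -> nat) (n0 : nat).
Hypothesis xpar : gr_params m J d x deg n0.
Let F n := isum (ipow m n) J.
Let iF n : is_ideal (F n). Proof. exact: powsum_ideal. Qed.

(** Every element of m has its n0-th power in (x) + J, so a regular sequence unrelated to x can be
    used in [kvanish_depth]. *)
Lemma regseq_kvanish xs : regseq m J xs -> (d <= size xs)%N ->
  kvanish x d deg (fun=> True) J 1.
Proof.
move=> [xsm [xsreg _]] dxs.
have E i y : (i <= size xs)%N ->
    isum J (igen (take i xs)) y <-> glin (fun=> True) J (fun k => xs`_k) i y.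
  move=> ixs; have szi : size (take i xs) = i by rewrite size_take_min; apply/minn_idPl.
  split=> [[a [b [Ja [c [szc bE]] ->]]]|[s [_ Js]]].
    exists (fun k => c`_k); split=> //.
    rewrite bE szi; under eq_bigr => k _ do rewrite nth_take //.
    by rewrite addrK.
  exists (y - \sum_(k < i) s k * xs`_k), (\sum_(k < i) s k * xs`_k); split=> //; last by rewrite subrK.
  exists (mkseq s i); rewrite size_mkseq szi; split=> //.
  by apply: eq_bigr => k _; rewrite nth_mkseq // nth_take.
have wJ : wmod (fun=> True) J.
  by split; [apply: ideal0|move=> a; apply: idealN|move=> a b; apply: idealD|move=> a b _; apply: idealM].
apply: (kvanish_depth (g := fun k => xs`_k) (k := size xs)) => //.
- by move=> i y ixs _ /(E i _ (ltnW ixs)) H; apply/(E i _ (ltnW ixs)); apply: xsreg.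
- move=> i ixs; exists n0.
  have [b [_ Jb]] := xpar.2 n0 (xs`_i ^+ n0) (leqnn n0) ltac:(
    rewrite -[X in ipow m X]mul1n; apply: ipow_exp => //; apply: ipow1; apply: xsm; exact: mem_nth).
  by exists b.
Qed.

(* gr_m(R/J) is the quotient gr_mem / gr_zero of a subring of {poly R}; gr_x j is the initial
   form of x j. *)
Definition gr_mem (p : {poly R}) := forall n, F n p`_n.
Definition gr_zero (p : {poly R}) := forall n, F n.+1 p`_n.
Definition gr_x j : {poly R} := x j *: 'X^(deg j).

Lemma gr_mem_wmod : wmod gr_mem gr_mem.
Proof.
split=> [n|a ma n|a b ma mb n|a b ma mb n].
- by rewrite coef0; apply: ideal0.
- by rewrite coefN; apply: idealN.
- by rewrite coefD; apply: idealD.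
- rewrite coefM; apply: ideal_sum => // i _.
  by rewrite -[n in F n](subnKC (leq_ord i)); apply: powsum_mul => //; [exact: ma|exact: mb].
Qed.

Lemma gr_zero_wmod : wmod gr_mem gr_zero.
Proof.
split=> [n|a ma n|a b ma mb n|a b ma mb n].
- by rewrite coef0; apply: ideal0.
- by rewrite coefN; apply: idealN.
- by rewrite coefD; apply: idealD.
- rewrite coefM; apply: ideal_sum => // i _.
  by rewrite -[n in F n.+1](subnKC (leq_ord i)) -addnS; apply: powsum_mul => //; [exact: ma|exact: mb].
Qed.

Lemma gr_memZXn a n : F n a -> gr_mem (a *: 'X^n).
Proof.
move=> Fa k; rewrite coefZ coefXn; have [->|_] := eqVneq; first by rewrite mulr1.
by rewrite mulr0; apply: ideal0.
Qed.

Lemma gr_zeroZXn a n : F n.+1 a -> gr_zero (a *: 'X^n).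
Proof.
move=> Fa k; rewrite coefZ coefXn; have [->|_] := eqVneq; first by rewrite mulr1.
by rewrite mulr0; apply: ideal0.
Qed.

Lemma gr_mem_x j : (j < d)%N -> gr_mem (gr_x j).
Proof. by move=> /xpar.1[_ _ xj]; apply: gr_memZXn; apply: isum_l. Qed.

Lemma gr_plus_exp g n : gr_mem g -> F 1 g`_0 -> forall k, (k < n)%N -> F k.+1 (g ^+ n)`_k.
Proof.
move=> mg g0; elim: n => // n IH k kn.
have mgn : gr_mem (g ^+ n).
  case: gr_mem_wmod => _ _ _ mM; elim: (n) => [|l IHl]; last by rewrite exprS; apply: mM.
  move=> l; rewrite expr0 coefC; case: l => [|l] /=; last exact: ideal0.
  exact: isum_l.
rewrite exprS coefM; apply: ideal_sum => // -[[|i] ik] _ /=.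
  by rewrite subn0 -add1n; apply: powsum_mul => //; apply: mgn.
have -> : k.+1 = (i.+1 + (k - i.+1).+1)%N by move: ik; clear; lia.
apply: powsum_mul => //; first exact: mg.
by apply: IH; move: ik kn; clear; lia.
Qed.

(** The regular sequence of the graded ring may be inhomogeneous. Still, g^n0 has no component below
    degree n0 in the graded ring, and each remaining component is a combination of the initial
    forms; the coefficients are reassembled into polynomials. *)
Lemma gr_plus_nilpotent g : gr_mem g -> F 1 g`_0 ->
  exists e (b : nat -> {poly R}), (forall j, (j < d)%N -> gr_mem (b j)) /\
    gr_zero (g ^+ e - \sum_(j < d) gr_x j * b j).
Proof.
move=> mg g0; exists n0; set p := g ^+ n0.
have mp : gr_mem p.
  case: gr_mem_wmod => _ _ _ mM; rewrite /p; elim: (n0) => [|l IHl]; last by rewrite exprS; apply: mM.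
  move=> l; rewrite expr0 coefC; case: l => [|l] /=; last exact: ideal0.
  exact: isum_l.
have zp : forall k, (k < n0)%N -> F k.+1 p`_k by apply: gr_plus_exp.
have H n : (n0 <= n)%N -> exists b : nat -> R, (forall j, (j < d)%N -> ipow m (n - deg j) (b j)) /\
    J (p`_n - \sum_(j < d) x j * b j).
  move=> n0n; have [u [v [nu Jv ->]]] := mp n.
  have [b [nb Jb]] := xpar.2 n u n0n nu; exists b; split=> //.
  by rewrite addrAC; apply: idealD.
pose B n := epsilon (inhabits (fun _ : nat => 0 : R)) (fun b => (forall j, (j < d)%N -> ipow m (n - deg j) (b j)) /\
    J (p`_n - \sum_(j < d) x j * b j)).
have HB n : (n0 <= n)%N -> _ := fun n0n => epsilon_spec (inhabits (fun _ : nat => 0 : R)) _ (H n n0n).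
rewrite -/(B _) in HB.
exists (fun j => \sum_(n < size p | (n0 <= n)%N) B n j *: 'X^(n - deg j)); split.
  move=> j jd; case: gr_mem_wmod => m0 _ mD _; apply: (big_ind gr_mem m0 mD) => -[n np] /= n0n.
  by apply: gr_memZXn; apply: isum_l => //; apply: (HB n n0n).1.
have -> : \sum_(j < d) gr_x j * (\sum_(n < size p | (n0 <= n)%N) B n j *: 'X^(n - deg j)) =
    \sum_(n < size p | (n0 <= n)%N) (\sum_(j < d) x j * B n j) *: 'X^n.
  under eq_bigr => j _ do rewrite mulr_sumr.
  rewrite exchange_big; apply: eq_bigr => n n0n /=; rewrite scaler_suml.
  apply: eq_bigr => j _; rewrite -scalerAl -scalerAr scalerA -exprD subnKC //.
  by apply: leq_trans n0n; case: (xpar.1 j (ltn_ord j)).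
have z0 := gr_zero_wmod; case: (z0) => zz0 _ zD _.
have pE : p = \sum_(n < size p) p`_n *: 'X^n by rewrite -[LHS]coefK poly_def.
rewrite [X in X - _]pE (bigID (fun n : 'I_(size p) => (n0 <= n)%N)) /= addrAC -sumrB.
apply: (zD); apply: (big_ind gr_zero zz0 zD) => -[n np] /= n0n.
  by rewrite -scalerBl; apply: gr_zeroZXn; apply: isum_r; [apply: ipow_ideal|apply: (HB n n0n).2].
by apply: gr_zeroZXn; apply: zp; rewrite ltnNge.
Qed.

(** [grElt] asks only that the high components vanish in the graded ring, not that their
    representatives be 0; a polynomial representative is chosen. *)
Definition gr_trunc (f : nat -> R) :=
  epsilon (inhabits (0 : {poly R})) (fun p => gr_mem p /\ grEq m J f (fun n => p`_n)).

Lemma gr_truncP f : grElt m J f -> gr_mem (gr_trunc f) /\ grEq m J f (fun n => (gr_trunc f)`_n).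
Proof.
move=> [mf [B fB]]; apply: (epsilon_spec (inhabits (0 : {poly R})) (fun p => gr_mem p /\ grEq m J f (fun n => p`_n))).
exists (\poly_(n < B) f n); split=> n; rewrite coef_poly; case: ltnP => [_|Bn].
- exact: mf.
- exact: ideal0.
- by rewrite subrr; apply: ideal0; apply: (iF n.+1).
- by rewrite subr0; apply: fB.
Qed.

Lemma gr_mem_grElt p : gr_mem p -> grElt m J (fun n => p`_n).
Proof.
move=> mp; split=> //; exists (size p) => n pn; rewrite nth_default //.
by apply: ideal0; apply: (iF n.+1).
Qed.

Lemma grMul_congr f g p q n : (forall k, F k (f k)) -> (forall k, F k (g k)) ->
  gr_mem p -> gr_mem q -> grEq m J f (fun n => p`_n) -> grEq m J g (fun n => q`_n) ->
  F n.+1 (grMul f g n - (p * q)`_n).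
Proof.
move=> mf mg mp mq fp gq; rewrite /grMul coefM -sumrB; apply: ideal_sum => // i _.
have -> : f i * g (n - i)%N - p`_i * q`_(n - i) =
    (f i - p`_i) * g (n - i)%N + p`_i * (g (n - i)%N - q`_(n - i)) by ring.
apply: idealD => //.
  rewrite -[n in F n.+1](subnKC (leq_ord i)) -addSn.
  by apply: powsum_mul => //; apply: mg.
rewrite -[n in F n.+1](subnKC (leq_ord i)) -addnS.
by apply: powsum_mul => //; apply: mp.
Qed.

Lemma grIdeal_glin (xs : seq (nat -> R)) i p : (i <= size xs)%N ->
  (forall k, (k < size xs)%N -> grElt m J (nth (gr0 R) xs k)) -> gr_mem p ->
  grIdeal m J (take i xs) (fun n => p`_n) <->
  glin gr_mem gr_zero (fun k => gr_trunc (nth (gr0 R) xs k)) i p.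
Proof.
move=> ixs exs mp; have szi : size (take i xs) = i by rewrite size_take_min; apply/minn_idPl.
have exs' k : (k < i)%N -> grElt m J (nth (gr0 R) xs k) by move=> ki; apply: exs; apply: leq_trans ixs.
have gxs k : (k < i)%N -> gr_mem (gr_trunc (nth (gr0 R) xs k)) by move=> /exs'/gr_truncP[].
have congr_sum (a : nat -> nat -> R) (s : nat -> {poly R}) n :
    (forall k, (k < i)%N -> [/\ forall l, F l (a k l), gr_mem (s k) & grEq m J (a k) (fun l => (s k)`_l)]) ->
    F n.+1 (\sum_(k < i) grMul (a k) (nth (gr0 R) (take i xs) k) n -
            (\sum_(k < i) s k * gr_trunc (nth (gr0 R) xs k))`_n).
  move=> as_; rewrite coef_sum -sumrB; apply: ideal_sum => // -[k ki] _ /=.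
  have [ma ms eas] := as_ k ki; rewrite nth_take //.
  have [me _] := exs' k ki; have [mt et] := gr_truncP (exs' k ki).
  exact: grMul_congr.
split=> [[a [sza ea eqp]]|[s [Ws Ls]]].
  rewrite sza szi in ea.
  exists (fun k => gr_trunc (nth (gr0 R) a k)); split=> [k ki|n].
    exact: (gr_truncP (ea k ki)).1.
  have := eqp n; rewrite szi => H; rewrite coefB -(subrKA (\sum_(k < i) grMul (nth (gr0 R) a k) (nth (gr0 R) (take i xs) k) n)).
  apply: idealD => //.
  apply: (congr_sum (fun k => nth (gr0 R) a k) (fun k => gr_trunc (nth (gr0 R) a k))) => k ki.
  by have [ma mt] := gr_truncP (ea k ki); split=> //; case: (ea k ki).
exists (mkseq (fun k n => (s k)`_n) i); rewrite size_mkseq szi; split=> // [k ki|n].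
  by rewrite nth_mkseq //; apply: gr_mem_grElt; apply: Ws.
rewrite (eq_bigr (fun k : 'I_i => grMul (fun n => (s k)`_n) (nth (gr0 R) (take i xs) k) n)); last first.
  by move=> k _; rewrite nth_mkseq.
have H : F n.+1 (\sum_(k < i) grMul (fun n => (s k)`_n) (nth (gr0 R) (take i xs) k) n -
    (\sum_(k < i) s k * gr_trunc (nth (gr0 R) xs k))`_n).
  apply: (congr_sum (fun k n => (s k)`_n) s) => k ki; split=> [l||l]; first exact: (Ws k ki).
    exact: Ws.
  by rewrite subrr; apply: ideal0; apply: (iF l.+1).
rewrite -[_ - _](subrKA (\sum_(k < i) s k * gr_trunc (nth (gr0 R) xs k))`_n).
apply: (idealD (iF n.+1)); first by rewrite -coefB; apply: Ls.
by rewrite -opprB; apply: idealN.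
Qed.

Lemma gr_regseq_kvanish xs k : gr_regseq m J xs -> (k <= size xs)%N -> (d <= k + 1)%N ->
  kvanish gr_x d deg gr_mem gr_zero 2.
Proof.
move=> [exs [reg _]] kxs dk.
have exs' i : (i < size xs)%N -> grElt m J (nth (gr0 R) xs i) by move=> /exs[].
apply: (kvanish_depth (g := fun k => gr_trunc (nth (gr0 R) xs k)) (k := k)).
- exact: gr_mem_wmod.
- exact: gr_zero_wmod.
- exact: gr_mem_x.
- by move=> i ik; apply: (gr_truncP (exs' i (leq_trans ik kxs))).1.
- move=> i p ik mp; have ixs := leq_trans ik kxs.
  have [mt et] := gr_truncP (exs' i ixs).
  have mtp : gr_mem (gr_trunc (nth (gr0 R) xs i) * p) by case: gr_mem_wmod => _ _ _; apply.
  move/(grIdeal_glin (ltnW ixs) exs' mtp) => H; apply/(grIdeal_glin (ltnW ixs) exs' mp).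
  apply: reg => //; first exact: gr_mem_grElt.
  case: H => a [sza ea eqa]; exists a; split=> // n.
  rewrite -[_ - _](subrKA (gr_trunc (nth (gr0 R) xs i) * p)`_n).
  apply: (idealD (iF n.+1)) (eqa n); apply: grMul_congr => //.
    by case: (exs' i ixs).
  by move=> l; rewrite subrr; apply: ideal0; apply: (iF l.+1).
- move=> i ik; have ixs := leq_trans ik kxs; have [mt et] := gr_truncP (exs' i ixs).
  apply: gr_plus_nilpotent => //; have [_ g0] := exs i ixs.
  rewrite -(subKr (nth (gr0 R) xs i 0%N) (gr_trunc _)`_0).
  by apply: idealB => //; apply: et.
- by move: dk; clear; lia.
Qed.

End KoszulVanishing.

(** * From vanishing to exactness of the graded Koszul complex in degrees >= n0 *)

Section KoszulFiltration.
Local Open Scope ring_scope.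
Variable R : comNzRingType.
Variables m J : R -> Prop.
Hypotheses (im : is_ideal m) (iJ : is_ideal J).
Variables (d : nat) (x : nat -> R) (deg : nat -> nat) (n0 : nat).
Hypothesis xpar : gr_params m J d x deg n0.
Let F n := isum (ipow m n) J.
Let iF n : is_ideal (F n). Proof. exact: powsum_ideal. Qed.

(* The degree n part of the Koszul complex of gr_m(R/J) is kfilt n / kfilt n.+1; truncated
   subtraction makes the components of weight > n equal to R in both, as they should. *)
Definition kfilt n : koszul R d -> Prop := kall deg (fun _ w => isum (ipow m (n - w)) J).

Lemma kfilt_kadd n : kadd (fun _ w => isum (ipow m (n - w)) J).
Proof. by apply: kideal_kadd => i w; apply: iF. Qed.

Lemma kfiltJ n z : kall deg (fun _ _ => J) z -> kfilt n z.
Proof. by apply: kall_mono => i w y; apply: isum_r; apply: ipow_ideal. Qed.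

Lemma kfilt_leq n n' z : (n <= n')%N -> kfilt n' z -> kfilt n z.
Proof. by move=> nn; apply: kall_mono => i w y; apply: powsum_leq => //; apply: leq_sub2r. Qed.

Lemma kfilt_homot j n k z : (n <= k + deg j)%N -> kfilt k z -> kfilt n (homot j z).
Proof.
move=> nk; apply: kall_homot; first exact: kfilt_kadd.
by move=> i w y; apply: powsum_leq => //; move: nk; clear; lia.
Qed.

Lemma Jkadd : kadd (fun (_ _ : nat) => J).
Proof. by apply: kideal_kadd. Qed.

(** Exactness in one internal degree but in all homological degrees, H_0 included, as the Euler
    characteristic requires. *)
Definition gr_exact n := forall z, kfilt n z -> kfilt n.+1 (bd x z) ->
  exists2 w, kfilt n w & kfilt n.+1 (z - bd x w).

Section CohenMacaulay.
Hypothesis vanR : kvanish x d deg (fun=> True) J 1.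
Hypothesis vanG : kvanish (gr_x x deg) d deg (gr_mem m J) (gr_zero m J) 2.

(** [vanG] concerns polynomials, whose internal degrees may mix. [sg] places a component of weight w
    in degree n - w, and [th] extracts that degree from the solution, which need not be
    homogeneous. *)
Lemma gr_kvanish2 n z : kfilt n z -> kall deg (@zero_below R 2) z -> kfilt n.+1 (bd x z) ->
  exists w, [/\ kfilt n w, kall deg (@zero_below R 3) w & kfilt n.+1 (z - bd x w)].
Proof.
move=> nz tz nbz.
pose sg (_ w : nat) (y : R) : {poly R} := if (w <= n)%N then y *: 'X^(n - w) else 0.
pose th (_ w : nat) (p : {poly R}) : R := if (w <= n)%N then p`_(n - w) else 0.
have sgD i w : {morph sg i w : y y' / y + y'}.
  by move=> y y'; rewrite /sg; case: ifP; rewrite ?addr0 // scalerDl.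
have sgN i w : {morph sg i w : y / - y}.
  by move=> y; rewrite /sg; case: ifP; rewrite ?oppr0 // scaleNr.
have thD i w : {morph th i w : y y' / y + y'}.
  by move=> y y'; rewrite /th; case: ifP; rewrite ?addr0 // coefD.
have thN i w : {morph th i w : y / - y}.
  by move=> y; rewrite /th; case: ifP; rewrite ?oppr0 // coefN.
have z0 := gr_zero_wmod im iJ; have [zz0 zN zD _] := z0; have [mz0 _ _ _] := gr_mem_wmod im iJ.
have Zm : kall deg (fun _ _ => gr_mem m J) (kmap deg sg z).
  apply: kall_kmap nz => i w y Fy; rewrite /sg; case: ifP => // _.
  exact: gr_memZXn.
have Zt : kall deg (@zero_below _ 2) (kmap deg sg z).
  by apply: kall_kmap tz => i w y ty it; rewrite /sg ty // scale0r if_same.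
have Zb : kall deg (fun _ _ => gr_zero m J) (bd (gr_x x deg) (kmap deg sg z)).
  set A := kmap deg sg (bd x z); set B := bd _ _; rewrite -(subKr A B) /A /B {A B}.
  apply: kaddB; first exact: wmod_kadd z0.
    apply: kall_kmap nbz => i w y; rewrite /sg; case: ifP => // wn.
    by rewrite subSn // => Fy; apply: gr_zeroZXn.
  apply: kmap_bd => //.
  move=> i w j y jd; have [_ _ xj] := xpar.1 j jd; rewrite /sg.
  have [wn|nw] := leqP w n; last first.
    by rewrite leqNgt ltn_addr // mulr0 subrr.
  have [wjn|nwj] := leqP (w + deg j) n.
    rewrite /gr_x -scalerAl -scalerAr scalerA -exprD.
    have -> : (deg j + (n - (w + deg j)) = n - w)%N by move: wjn; clear; lia.
    by rewrite subrr.
  (* For w <= n < w + [deg j] the component is sent to 0, consistently: x_j y has order at least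
     [deg j] >= n - w + 1 and so vanishes in degree n - w. *)
  rewrite mulr0 subr0; apply: gr_zeroZXn => //; apply: (@powsum_leq _ _ _ _ (deg j)) => //.
    by move: nwj wn; clear; lia.
  by apply: isum_l => //; apply: idealMR => //; apply: ipow_ideal.
have [W [Wm Wt ZW]] := vanG Zm Zt Zb.
exists (kmap deg th W); split.
- apply: kall_kmap Wm => i w p mp; rewrite /th; case: ifP => _; [exact: mp|exact: ideal0 (iF _)].
- by apply: kall_kmap Wt => i w p tp it; rewrite /th tp // coef0 if_same.
rewrite -[_ - _](subrKA (kmap deg th (kmap deg sg z))).
apply: kaddD; first exact: kfilt_kadd.
  rewrite kmap_kmap; apply: kall_sub_kmap nz => i w y _; rewrite /th /sg.
  have [wn|nw] := leqP w n.
    by rewrite coefZ coefXn eqxx mulr1 subrr; apply: ideal0 (iF _).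
  by rewrite subr0 (_ : n.+1 - w = 0)%N; [apply: isum_l|apply/eqP].
rewrite -[_ - _](subrKA (kmap deg th (bd (gr_x x deg) W))).
apply: kaddD; first exact: kfilt_kadd.
  rewrite -kmapB //; apply: kall_kmap ZW => i w p zp; rewrite /th.
  by case: ifP => [wn|_]; [rewrite subSn //; apply: zp|apply: ideal0 (iF _)].
apply: kmap_bd => //; first exact: kfilt_kadd.
move=> i w j p jd; rewrite /th.
suff -> : (if (w <= n)%N then (gr_x x deg j * p)`_(n - w) else 0) =
    x j * (if (w + deg j <= n)%N then p`_(n - (w + deg j)) else 0).
  by rewrite subrr; apply: ideal0 (iF _).
rewrite /gr_x -scalerAl coefZ coefXnM.
have [wn|nw] := leqP w n; last by rewrite leqNgt ltn_addr // mulr0.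
by rewrite ltn_subLR // ltnNge; case: leqP; rewrite ?subnDA.
Qed.

(** At n = 0 this is the vanishing for R/J. If a cycle z of level n + 1 bounds w of level n, then bd
    w has level n + 1, so w is a cycle of the graded complex in homological degrees >= 2. It is thus
    bd v up to level n + 1, and w - bd v replaces w. *)
Lemma kfilt_kvanish n z : kfilt n z -> kall deg (@zero_below R 1) z ->
  kall deg (fun _ _ => J) (bd x z) ->
  exists w, [/\ kfilt n w, kall deg (@zero_below R 2) w & kall deg (fun _ _ => J) (z - bd x w)].
Proof.
elim: n z => [|n IH] z nz tz Jz.
  have [|w [_ tw Jw]] := vanR _ tz Jz; first exact: kall_all.
  by exists w; split=> //; apply: kall_all => i v y; apply: isum_l.
have [w [nw tw Jw]] := IH z (kfilt_leq (leqnSn n) nz) tz Jz.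
have bw : kfilt n.+1 (bd x w).
  rewrite -[bd x w](subKr z); apply: kaddB => //; [exact: kfilt_kadd|exact: kfiltJ].
have [v [nv tv wv]] := gr_kvanish2 nw tw bw.
exists (w - bd x v); split=> //; last by rewrite bdB bd_bd subr0.
by apply: kaddB => //; [apply: zero_below_kadd|apply: zero_below_bd].
Qed.

(** The bottom component, of order n >= n0, is a combination of the x_j with coefficients of the
    right order, hence a boundary modulo [J]. The rest starts in degree 1 and has the same boundary
    as z. *)
Lemma kfilt_acyclic n z : (n0 <= n)%N -> kfilt n z -> kall deg (fun _ _ => J) (bd x z) ->
  exists2 w, kfilt n w & kall deg (fun _ _ => J) (z - bd x w).
Proof.
move=> n0n nz Jz.
have [u [v [nu Jv uv]]] := kall_bot nz; rewrite subn0 in nu.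
have [b [nb Jb]] := xpar.2 n u n0n nu.
pose s : koszul R d := \sum_(j < d) homot j (kincl d (b j)).
have ns : kfilt n s.
  apply: (kadd_sum (f := fun j => homot j (kincl d (b j)))); first exact: kfilt_kadd.
  move=> j jd; apply: (@kfilt_homot _ _ (n - deg j)); first by clear; lia.
  apply: kall_incl => [i w|]; first exact: ideal0 (iF _).
  by rewrite subn0; apply: isum_l => //; apply: nb.
have bs : bd x s = kincl d (\sum_(j < d) x j * b j).
  rewrite kincl_sum bd_sum; apply: eq_bigr => j _.
  have := bd_homot x (kincl d (b j)) (ltn_ord j); rewrite bd_kincl homot0 addr0.
  by move=> ->.
have nbot : kfilt n (kincl d (kbot z)).
  apply: kall_incl => [i w|]; first exact: ideal0 (iF _).
  by have := kall_bot nz.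
have [||w [nw _ Jw]] := kfilt_kvanish (n := n) _ (kall_sub_bot deg z).
- by apply: kaddB => //; apply: kfilt_kadd.
- by rewrite bdB bd_kincl subr0.
exists (w + s); first by apply: kaddD => //; apply: kfilt_kadd.
have -> : z - bd x (w + s) = (z - kincl d (kbot z) - bd x w) + kincl d (kbot z - \sum_(j < d) x j * b j).
  rewrite bdD bs -[kbot z - _]addrC -mulN1r kinclP scaleN1r.
  by rewrite opprD !addrA [RHS]addrAC; congr (_ - _); rewrite [RHS]addrAC subrK.
apply: kaddD => //; first exact: Jkadd.
apply: kall_incl => [i w'|]; first exact: ideal0.
by rewrite uv addrAC; apply: idealD.
Qed.

(** The quotient of two acyclic complexes is acyclic: correct z by an element of level n + 1 with
    the same boundary modulo [J], then apply acyclicity at level n. *)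
Lemma gr_exact_CM n : (n0 <= n)%N -> gr_exact n.
Proof.
move=> n0n z nz nbz.
have [|u nu Ju] := kfilt_acyclic (leqW n0n) nbz; first by rewrite bd_bd; apply: kall0 => i w; apply: ideal0.
have [||w nw Jw] := kfilt_acyclic (z := z - u) n0n.
- by apply: kaddB => //; [apply: kfilt_kadd|apply: kfilt_leq nu].
- by rewrite bdB.
exists w => //; have -> : z - bd x w = z - u - bd x w + u by rewrite addrAC subrK.
by apply: kaddD => //; [apply: kfilt_kadd|apply: kfiltJ].
Qed.

End CohenMacaulay.

End KoszulFiltration.

(** * Exactness in large degrees for a general ideal *)

Section StableCycles.
Local Open Scope ring_scope.
Variable R : comNzRingType.
Hypothesis nR : noetherian R.

Inductive smul (V : lmodType R) (A : R -> Prop) (B : V -> Prop) : V -> Prop :=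
| smul0 : smul A B 0
| smul_cons a b z : A a -> B b -> smul A B z -> smul A B (a *: b + z).

Lemma smulD (V : lmodType R) A (B : V -> Prop) u v : smul A B u -> smul A B v -> smul A B (u + v).
Proof.
move=> + Bv; elim=> [|a b z Aa Bb _ IH]; first by rewrite add0r.
by rewrite -addrA; apply: smul_cons.
Qed.

Lemma smul_min (V : lmodType R) (A : R -> Prop) (B P : V -> Prop) : P 0 -> (forall u v, P u -> P v -> P (u + v)) ->
  (forall a b, A a -> B b -> P (a *: b)) -> forall z, smul A B z -> P z.
Proof. by move=> P0 PD PAB z; elim=> // a b v Aa Bb _; apply: PD; apply: PAB. Qed.

Lemma smulZ (V : lmodType R) A (B : V -> Prop) r u : is_ideal A -> smul A B u -> smul A B (r *: u).
Proof.
move=> iA; elim=> [|a b z Aa Bb _ IH]; first by rewrite scaler0; apply: smul0.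
by rewrite scalerDr scalerA; apply: smul_cons => //; apply: idealM.
Qed.

Variable m : R -> Prop.
Hypothesis im : is_ideal m.

Definition submod (V : lmodType R) (Q : V -> Prop) :=
  [/\ Q 0, (forall u v, Q u -> Q v -> Q (u + v)) & (forall r u, Q u -> Q (r *: u))].

Definition gmod (V : lmodType R) (Q : nat -> V -> Prop) :=
  (forall n, submod (Q n)) /\ (forall n a z, m a -> Q n z -> Q n.+1 (a *: z)).

(** Induction on d through the mapping cone: the elements of [Q] with second component 0, and the
    second components of [Q] with degrees shifted by [deg d], are graded families in the smaller
    complex. *)
Lemma koszul_stab deg d (Q : nat -> koszul R d -> Prop) : gmod Q ->
  (forall n z, Q n z -> kall deg (fun _ w => ipow m (n - w)) z) ->
  exists D, forall n, (D <= n)%N -> forall z, Q n.+1 z -> smul m (Q n) z.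
Proof.
elim: d Q => [|d IH] Q [sQ mQ] Qm.
  have gQ : gfam m Q by split=> *; [apply: sQ|apply: mQ].
  have [D HD] := rees_stab nR im gQ; exists D => n Dn z Qz.
  have nz : ipow m n.+1 z by have := Qm _ _ Qz; rewrite /= ?subn0.
  apply: (iprod_min (I := smul (V := R^o) m (Q n)) _ _ (HD n Dn z nz Qz)).
    by split; [apply: smul0|apply: smulD|move=> r a; apply: smulZ].
  move=> a b ma [_ Qb]; rewrite -[a * b]addr0; apply: (@smul_cons R^o) => //.
  exact: smul0.
have [|n z Qz|D1 HD1] := IH (fun n a => Q n (a, 0)).
- split=> [n|n a z ma Qz].
    have [Q0 QD QZ] := sQ n; split=> // [u v Qu Qv|r u Qu].
      by have := QD _ _ Qu Qv; rewrite -[X in Q n X -> _]/(u + v, 0 + 0) addr0.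
    by have := QZ r _ Qu; rewrite -[X in Q n X -> _]/(r *: u, r *: 0) scaler0.
  by have := mQ n a _ ma Qz; rewrite -[X in Q _ X -> _]/(a *: z, a *: 0) scaler0.
- by case: (Qm _ _ Qz).
have [|n z [a Qz]|D2 HD2] := IH (fun n b => exists a, Q (n + deg d)%N (a, b)).
- split=> [n|n a z ma [u Qz]].
    have [Q0 QD QZ] := sQ (n + deg d)%N; split=> [|u v [a Qu] [b Qv]|r u [a Qu]].
    + by exists 0.
    + by exists (a + b); apply: QD Qu Qv.
    + by exists (r *: a); apply: QZ Qu.
  by exists (a *: u); apply: mQ ma Qz.
- have [_] := Qm _ _ Qz; apply: kall_mono => i w y; by rewrite subnDr.
exists (D1 + (D2 + deg d))%N => n Dn [a b] Qab.
have [Q0 QD QZ] := sQ n.+1.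
have smQ z : smul m (Q n) z -> Q n.+1 z.
  by apply: smul_min => // r u mr Qu; apply: mQ.
have [a0 Qa0] : exists a0, smul m (Q n) (a0, b).
  have : smul m (fun b => exists a, Q (n - deg d + deg d)%N (a, b)) b.
    apply: HD2; first by move: Dn; clear; lia.
    by exists a; rewrite addSn subnK //; move: Dn; clear; lia.
  rewrite subnK; last by move: Dn; clear; lia.
  apply: (smul_min (P := fun b => exists a0, smul m (Q n) (a0, b))).
  - by exists 0; apply: smul0.
  - by move=> u v [u' Qu] [v' Qv]; exists (u' + v'); apply: smulD Qu Qv.
  - move=> r u mr [u' Qu]; exists (r *: u').
    by rewrite -[X in smul _ _ X]/(r *: (u', u)) -[r *: _]addr0; apply: smul_cons => //; apply: smul0.
have : smul m (fun a => Q n (a, 0)) (a - a0).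
  apply: HD1; first by move: Dn; clear; lia.
  have := QD _ _ Qab (QZ (-1) _ (smQ _ Qa0)); rewrite scaleN1r.
  by rewrite -[_ - _]/(a - a0, b - b) subrr.
move=> H; have -> : (a, b) = (a0, b) + (a - a0, 0) :> koszul R d.+1.
  by rewrite -[RHS]/(a0 + (a - a0), b + 0) addr0 addrC subrK.
apply: smulD => //; move: H; apply: (smul_min (P := fun u => smul m (Q n) (u, 0))).
- exact: smul0.
- move=> u v Qu Qv; have := smulD Qu Qv.
  by rewrite -[_ + _]/(u + v, 0 + 0) addr0.
- move=> r u mr Qu; have -> : (r *: u, 0) = r *: (u, 0) + 0 :> koszul R d.+1.
    by rewrite addr0 -[RHS]/(r *: u, r *: 0) scaler0.
  by apply: smul_cons => //; apply: smul0.
Qed.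

Lemma smul_stab_pow (V : lmodType R) (Q : nat -> V -> Prop) D :
  (forall n, (D <= n)%N -> forall z, Q n.+1 z -> smul m (Q n) z) ->
  forall n k, (D <= n)%N -> forall z, Q (n + k)%N z -> smul (ipow m k) (Q n) z.
Proof.
move=> HD n k Dn; elim: k => [|k IH] z.
  rewrite addn0 => Qz; rewrite -[z]scale1r -[1 *: z]addr0.
  by apply: smul_cons => //; apply: smul0.
rewrite addnS => Qz; move: (HD _ (leq_trans Dn (leq_addr k n)) z Qz).
apply: smul_min => [|u v|a b ma /IH]; [exact: smul0|exact: smulD|].
elim=> [|a' b' v ka Qb _ IHv]; first by rewrite scaler0; apply: smul0.
by rewrite scalerDr scalerA; apply: smul_cons => //; apply: ipowS_mul.
Qed.

(* The cycles of the Koszul complex of gr_m(R/J) form a finitely generated module over the Rees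
   algebra, and the ideal of the initial forms of the x_j kills the homology. *)
Lemma gr_exact_eventually J d x deg n0 : is_ideal J -> gr_params m J d x deg n0 ->
  exists n1, forall n, (n1 <= n)%N -> @gr_exact R m J d x deg n.
Proof.
move=> iJ xpar.
have iF n : is_ideal (isum (ipow m n) J) by apply: powsum_ideal.
(* The components are required to lie in powers of m rather than in m^k + J, since the stabilisation
   takes place in the Rees algebra of R; a cycle is first lifted modulo [J]. *)
pose Q n (z : koszul R d) := kall deg (fun _ w => ipow m (n - w)) z /\ kfilt m J deg n.+1 (bd x z).
have aQ n : kadd (fun _ w => ipow m (n - w)) by apply: kideal_kadd => i w; apply: ipow_ideal.
have [|n z []//|D HD] := @koszul_stab deg d Q.
  split=> [n|n a z ma [nz nbz]].
    split.
    - split; first by apply: kall0 => i w; apply: ideal0; apply: ipow_ideal.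
      by rewrite bd0; apply: kall0 => i w; apply: ideal0 (iF _).
    - move=> u v [nu bu] [nv bv]; split; first exact: kaddD.
      by rewrite bdD; apply: kaddD => //; apply: kfilt_kadd.
    - move=> r u [nu bu]; split.
        by apply: kallZ nu => i w y; apply: idealM; apply: ipow_ideal.
      by rewrite bdZ; apply: kallZ bu => i w y; apply: idealM.
  split.
    apply: kallZ nz => i w y ny; apply: (@ipow_leq _ _ _ (n - w).+1) => //.
      by clear; lia.
    exact: ipowS_mul.
  rewrite bdZ; apply: kallZ nbz => i w y Fy.
  apply: (@powsum_leq _ _ _ _ (1 + (n.+1 - w))) => //; first by clear; lia.
  by apply: powsum_mul => //; apply: isum_l => //; apply: ipow1.
have HD' := smul_stab_pow HD.
exists (D + n0)%N => n Dn z nz nbz.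
have [z' nz' Jz'] : exists2 u, kall deg (fun _ w => ipow m (n - w)) u & kall deg (fun _ _ => J) (z - 1 *: u).
  apply: kall_ex nz => i w y [u [v [nu Jv ->]]]; exists u => //.
  by rewrite mul1r addrC addKr.
rewrite scale1r in Jz'.
have Jbz : kall deg (fun _ _ => J) (bd x (z - z')).
  apply: kall_bd Jz'; first exact: Jkadd.
  by move=> i w j y _; apply: idealM.
have nbz' : kfilt m J deg n.+1 (bd x z').
  have -> : bd x z' = bd x z - bd x (z - z') by rewrite bdB subKr.
  by apply: kaddB; [apply: kfilt_kadd|exact: nbz|apply: kfiltJ].
suff [w nw zw] : exists2 w, kfilt m J deg n w & kfilt m J deg n.+1 (z' - bd x w).
  exists w => //; have -> : z - bd x w = z - z' + (z' - bd x w) by rewrite addrA subrK.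
  by apply: kaddD; [apply: kfilt_kadd|apply: kfiltJ|].
have Qz' : Q (n - n0 + n0)%N z' by rewrite subnK //; move: Dn; clear; lia.
have /HD' : (D <= n - n0)%N by move: Dn; clear; lia.
move=> /(_ _ _ Qz'); apply: (smul_min (P := fun z' => exists2 w, _ & _)).
- exists 0; first by apply: kall0 => i w; apply: ideal0 (iF _).
  by rewrite bd0 subr0; apply: kall0 => i w; apply: ideal0 (iF _).
- move=> u v [w nw uw] [w' nw' uw']; exists (w + w'); first by apply: kaddD => //; apply: kfilt_kadd.
  by rewrite bdD opprD addrACA; apply: kaddD => //; apply: kfilt_kadd.
move=> a q n0a [nq nbq].
have [b [nb Jb]] := xpar.2 n0 a (leqnn n0) n0a.
(* With a = sum of x_j b_j modulo [J], the homotopies make a q a boundary up to terms in bd q, which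
   lie one level deeper because q is a cycle. *)
exists (\sum_(j < d) homot j (b j *: q)).
  apply: (kadd_sum (f := fun j => homot j (b j *: q))); first exact: kfilt_kadd.
  move=> j jd; have [_ degn _] := xpar.1 j jd; have nbj := nb j jd.
  apply: (@kfilt_homot _ _ _ im iJ _ _ _ _ (n - deg j)); first by clear; lia.
  apply: kallZ nq => i w y ny; apply: isum_l => //.
  apply: (@ipow_leq _ _ _ (n0 - deg j + (n - n0 - w))) => //; last exact: ipow_mul.
  by move: Dn degn; clear; lia.
have -> : a *: q - bd x (\sum_(j < d) homot j (b j *: q)) =
    (a - \sum_(j < d) x j * b j) *: q + \sum_(j < d) homot j (bd x (b j *: q)).
  rewrite bd_sum scalerBl -addrA; congr (_ + _).
  rewrite scaler_suml -!sumrN -big_split /=; apply: eq_bigr => j _.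
  by rewrite -scalerA -(bd_homot x (b j *: q) (ltn_ord j)) opprD subrK.
apply: kaddD; first exact: kfilt_kadd.
  apply: kfiltJ => //; apply: (kallZ (F := fun _ _ _ => True)) (kall_all _ _ _) => // i w y _.
  exact: idealMR.
apply: (kadd_sum (f := fun j => homot j (bd x (b j *: q)))); first exact: kfilt_kadd.
move=> j jd; have [deg0 degn _] := xpar.1 j jd; have nbj := nb j jd.
apply: (@kfilt_homot _ _ _ im iJ _ _ _ _ (n.+1 - deg j)); first by clear; lia.
rewrite bdZ; apply: kallZ nbq => i w y Fy.
apply: (@powsum_leq _ _ _ _ (n0 - deg j + ((n - n0).+1 - w))) => //.
  by move: Dn degn; clear; lia.
by apply: powsum_mul => //; apply: isum_l.
Qed.

End StableCycles.

(** * Dimensions over the residue field and the Euler characteristic *)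

Section ResidueDimension.
Local Open Scope ring_scope.
Variable R : comNzRingType.
Variable m : R -> Prop.
Hypothesis im : is_ideal m.
Hypothesis m1 : ~ m 1.
Hypothesis mU : forall u, ~ m u -> exists v, v * u = 1.

Definition spans (V : lmodType R) (M L : V -> Prop) r (s : 'I_r -> V) :=
  (forall i, M (s i)) /\ forall y, M y -> exists c : 'I_r -> R, L (y - \sum_i c i *: s i).

(* The R/m-vector space M/L has dimension r. *)
Definition resdim (V : lmodType R) (M L : V -> Prop) r :=
  exists s : 'I_r -> V, spans M L s /\
    forall c : 'I_r -> R, L (\sum_i c i *: s i) -> forall i, m (c i).

Lemma submodB (V : lmodType R) (L : V -> Prop) u v : submod L -> L u -> L v -> L (u - v).
Proof. by case=> _ LD LZ Lu Lv; apply: LD => //; rewrite -scaleN1r; apply: LZ. Qed.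

Lemma submod_sum (V : lmodType R) (L : V -> Prop) r (f : 'I_r -> V) : submod L ->
  (forall i, L (f i)) -> L (\sum_i f i).
Proof. by case=> L0 LD _ Lf; apply: (big_ind L) => // i _; apply: Lf. Qed.

Lemma det_congr n (A B : 'M[R]_n) : (forall i j, m (A i j - B i j)) -> m (\det A - \det B).
Proof.
move=> mAB; rewrite /determinant -sumrB; apply: ideal_sum => // s _.
rewrite -mulrBr; apply: idealM => //.
apply: (big_ind2 (fun a b => m (a - b))) => [|a a' b b' ma mb|i _] //.
  by rewrite subrr; apply: ideal0.
have -> : a * b - a' * b' = a * (b - b') + b' * (a - a') by ring.
by apply: idealD => //; apply: idealM.
Qed.

Lemma det_mul_thin p q (A : 'M[R]_(p, q)) (B : 'M[R]_(q, p)) : (q < p)%N -> \det (A *m B) = 0.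
Proof.
move=> qp; have [k pE] : exists k, p = (q + k.+1)%N.
  by exists (p - q.+1)%N; move: qp; clear; lia.
subst p; have -> : A *m B = row_mx A 0 *m col_mx B (0 : 'M_(k.+1, _)).
  by rewrite mul_row_col mul0mx addr0.
rewrite det_mulmx (expand_det_col _ (rshift q ord0)) big1 ?mul0r // => i _.
by rewrite row_mxEr mxE mul0r.
Qed.

(** If q < p, expressing each system through the other gives a p x p matrix that factors through
    rank q, so its determinant is 0; by independence it is the identity modulo m, which puts 1 in
    m. *)
Lemma resdim_le (V : lmodType R) (M L : V -> Prop) p q : submod L ->
  resdim M L p -> resdim M L q -> (p <= q)%N.
Proof.
move=> sL [s [[Ms ss] inds]] [t [[Mt st] _]]; rewrite leqNgt; apply/negP => qp.
have [_ LD LZ] := sL.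
pose A i := epsilon (inhabits (fun _ => 0)) (fun c : 'I_q -> R => L (s i - \sum_j c j *: t j)).
have AP i : L (s i - \sum_j A i j *: t j).
  exact: (epsilon_spec (inhabits (fun _ => 0)) (fun c : 'I_q -> R => L (s i - \sum_j c j *: t j)) (st _ (Ms i))).
pose B j := epsilon (inhabits (fun _ => 0)) (fun c : 'I_p -> R => L (t j - \sum_i c i *: s i)).
have BP j : L (t j - \sum_i B j i *: s i).
  exact: (epsilon_spec (inhabits (fun _ => 0)) (fun c : 'I_p -> R => L (t j - \sum_i c i *: s i)) (ss _ (Mt j))).
pose C := (\matrix_(i, j) A i j) *m (\matrix_(j, i) B j i).
have CE i k : C i k = \sum_j A i j * B j k.
  by rewrite mxE; apply: eq_bigr => j _; rewrite !mxE.
apply: m1; rewrite -[1]opprK -[- 1]add0r -(det1 R p) -(det_mul_thin (\matrix_(i, j) A i j) (\matrix_(j, i) B j i) qp).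
apply: idealN => //; apply: det_congr => i k.
rewrite -[(1%:M : 'M[R]_p) i k]opprK; move: k; apply: (inds (fun k => C i k - _)).
have -> : \sum_k (C i k - - - (1%:M : 'M_p) i k) *: s k =
    - (s i - \sum_j A i j *: t j) - \sum_j A i j *: (t j - \sum_k B j k *: s k).
  rewrite (eq_bigr (fun k => \sum_j (A i j * B j k) *: s k - (1%:M : 'M_p) i k *: s k)); last first.
    by move=> k _; rewrite opprK scalerBl CE scaler_suml.
  rewrite sumrB exchange_big /=.
  have -> : \sum_k (1%:M : 'M_p) i k *: s k = s i.
    rewrite (bigD1 i) //= big1 ?addr0 => [|k ki]; first by rewrite mxE eqxx scale1r.
    by rewrite mxE eq_sym (negbTE ki) scale0r.
  rewrite opprB [RHS]addrAC -sumrB; congr (_ - _); apply: eq_bigr => j _.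
  rewrite scalerBr opprB addrC subrK scaler_sumr; apply: eq_bigr => k _.
  by rewrite scalerA.
apply: submodB => //; first by rewrite -scaleN1r; apply: LZ.
by apply: submod_sum => // j; apply: LZ.
Qed.

Lemma resdim_uniq (V : lmodType R) (M L : V -> Prop) p q : submod L ->
  resdim M L p -> resdim M L q -> p = q.
Proof. by move=> sL Mp Mq; apply/eqP; rewrite eqn_leq !(resdim_le (M := M) sL). Qed.

Lemma spans_resdim (V : lmodType R) (M L : V -> Prop) r (s : 'I_r -> V) : submod L ->
  spans M L s -> exists k, resdim M L k.
Proof.
move=> sL; have [_ LD LZ] := sL; elim: r s => [|r IH] s [Ms ss].
  by exists 0%N, s; split=> // c _ [].
case: (classic (forall c : 'I_r.+1 -> R, L (\sum_i c i *: s i) -> forall i, m (c i))) => [H|].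
  by exists r.+1, s.
move=> /not_all_ex_not[c] nH.
have [Lc /not_all_ex_not[i0 /mU[v vc]]] := imply_to_and _ _ nH.
apply: (IH (fun j => s (lift i0 j))); split=> // y My.
have [c' Lc'] := ss y My; exists (fun j => c' (lift i0 j) - c' i0 * v * c (lift i0 j)).
have -> : y - \sum_j (c' (lift i0 j) - c' i0 * v * c (lift i0 j)) *: s (lift i0 j) =
    (y - \sum_i c' i *: s i) + (c' i0 * v) *: (\sum_i c i *: s i).
  rewrite !(bigD1_ord i0) //= scalerDr scalerA -mulrA vc mulr1.
  rewrite -[RHS]addrA opprD addrACA addNr add0r; congr (y + _).
  rewrite scaler_sumr -!sumrN -big_split; apply: eq_bigr => j _ /=.
  by rewrite scalerBl opprB addrC scalerA.
by apply: LD => //; apply: LZ.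
Qed.

Lemma resdim_quot (V : lmodType R) (M N L : V -> Prop) r : submod N -> (forall y, L y -> N y) ->
  resdim M L r -> exists k, resdim M N k.
Proof.
move=> sN LN [s [[Ms ss] _]]; apply: (spans_resdim (s := s)) => //; split=> // y /ss[c Lc].
by exists c; apply: LN.
Qed.

Lemma resdim_add (V : lmodType R) (M N L : V -> Prop) p q : submod N -> submod L ->
  (forall y, L y -> N y) -> (forall y, N y -> M y) -> (forall a y, m a -> M y -> L (a *: y)) ->
  resdim M N p -> resdim N L q -> resdim M L (p + q).
Proof.
move=> sN sL LN NM mML [s [[Ms ss] inds]] [t [[Nt st] indt]].
have [_ ND NZ] := sN.
pose u (i : 'I_(p + q)) := match split i with inl j => s j | inr k => t k end.
have ul j : u (lshift q j) = s j by rewrite /u (unsplitK (inl j)).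
have ur k : u (rshift p k) = t k by rewrite /u (unsplitK (inr k)).
have sumu (c : 'I_(p + q) -> R) : \sum_i c i *: u i =
    \sum_j c (lshift q j) *: s j + \sum_k c (rshift p k) *: t k.
  by rewrite big_split_ord; congr (_ + _); apply: eq_bigr => i _; rewrite ?ul ?ur.
exists u; split.
  split=> [i|y My]; first by rewrite /u; case: (split i) => // k; apply: NM.
  have [c Nc] := ss y My; have [e Le] := st _ Nc.
  exists (fun i => match split i with inl j => c j | inr k => e k end); rewrite sumu opprD addrA.
  congr (L (_ - _ - _)) : Le; apply: eq_bigr => i _; first by rewrite (unsplitK (inl i)).
  by rewrite (unsplitK (inr i)).
move=> c; rewrite sumu => Lc.
have mc j : m (c (lshift q j)).
  move: j; apply: (inds (fun j => c (lshift q j))); rewrite -[X in N X](addrK (\sum_k c (rshift p k) *: t k)).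
  by apply: submodB => //; [apply: LN|apply: submod_sum => // k; apply: NZ].
have mc' k : m (c (rshift p k)).
  move: k; apply: (indt (fun k => c (rshift p k))); rewrite -[X in L X](addKr (\sum_j c (lshift q j) *: s j)) addrC.
  by apply: submodB => //; apply: submod_sum => // j; apply: mML.
by move=> i; rewrite -(splitK i); case: (split i).
Qed.

Lemma resdim_iso (V V' : lmodType R) (f : V -> V') (M L : V -> Prop) (M' L' : V' -> Prop) r :
  (forall a u v, f (a *: u + v) = a *: f u + f v) -> submod M -> submod L' ->
  (forall y, M y -> M' (f y)) -> (forall y, L y -> L' (f y)) ->
  (forall y, M y -> L' (f y) -> L y) -> (forall y', M' y' -> exists2 y, M y & L' (y' - f y)) ->
  resdim M L r -> resdim M' L' r.
Proof.
move=> fP sM sL' MM' LL' inj surj [s [[Ms ss] inds]].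
have [_ LD' _] := sL'; have [M0 MD MZ] := sM.
have f0 : f 0 = 0 by have := fP (-1) 0 0; rewrite !scaleN1r oppr0 !addr0 addNr.
have fD u v : f (u + v) = f u + f v by have := fP 1 u v; rewrite !scale1r.
have fZ a u : f (a *: u) = a *: f u by have := fP a u 0; rewrite f0 !addr0.
have fsum (c : 'I_r -> R) : \sum_i c i *: f (s i) = f (\sum_i c i *: s i).
  by rewrite (big_morph f fD f0); apply: eq_bigr => i _; rewrite fZ.
exists (fun i => f (s i)); split; last first.
  move=> c; rewrite fsum => Lc; apply: inds; apply: inj => //.
  by apply: submod_sum => // i; apply: MZ.
split=> [i|y' /surj[y My Ly]]; first exact: MM'.
have [c Lc] := ss y My; exists c; rewrite fsum -(subrKA (f y)); apply: LD' => //.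
by have := LL' _ Lc; rewrite fD -[- _]scaleN1r fZ scaleN1r.
Qed.

Lemma resdim_ext (V : lmodType R) (M L M' L' : V -> Prop) r :
  (forall y, M y <-> M' y) -> (forall y, L y <-> L' y) -> resdim M L r -> resdim M' L' r.
Proof.
move=> MM LL [s [[Ms ss] inds]]; exists s; split; first split.
- by move=> i; apply/MM.
- by move=> y /MM/ss[c /LL Lc]; exists c.
- by move=> c /LL; apply: inds.
Qed.

Lemma resdim_prod (V V' : lmodType R) (M L : V -> Prop) (M' L' : V' -> Prop) p q :
  submod M -> submod L -> submod M' -> submod L' ->
  (forall y, L y -> M y) -> (forall y, L' y -> M' y) ->
  (forall a y, m a -> M y -> L (a *: y)) -> (forall a y, m a -> M' y -> L' (a *: y)) ->
  resdim M L p -> resdim M' L' q ->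
  resdim (V := (V * V')%type) (fun z => M z.1 /\ M' z.2) (fun z => L z.1 /\ L' z.2) (p + q).
Proof.
move=> sM sL sM' sL' LM LM' mML mML' Mp Mq.
have sprod (A : V -> Prop) (A' : V' -> Prop) : submod A -> submod A' ->
    submod (V := (V * V')%type) (fun z => A z.1 /\ A' z.2).
  case=> A0 AD AZ [A0' AD' AZ']; split=> [//|u v [? ?] [? ?]|r u [? ?]].
    by split; [apply: AD|apply: AD'].
  by split; [apply: AZ|apply: AZ'].
apply: (resdim_add (N := fun z => L z.1 /\ M' z.2)).
- exact: sprod.
- exact: sprod.
- by move=> y [? ?]; split=> //; apply: LM'.
- by move=> y [? ?]; split=> //; apply: LM.
- by move=> a y ma [? ?]; split; [apply: mML|apply: mML'].
- apply: (resdim_iso (f := fun u => (u, 0) : (V * V')%type)) Mp => //.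
  + by move=> a u v; congr pair; rewrite /= scaler0 addr0.
  + exact: sprod.
  + by move=> y My; split=> //; case: sM'.
  + by move=> y Ly; split=> //; case: sM'.
  + by move=> y _ [].
  + move=> [y y'] [My My']; exists y => //; split; first by rewrite /= subrr; case: sL.
    by rewrite /= subr0.
- apply: (resdim_iso (f := fun u => (0, u) : (V * V')%type)) Mq => //.
  + by move=> a u v; congr pair; rewrite /= scaler0 addr0.
  + exact: sprod.
  + by move=> y My; split=> //; case: sL.
  + by move=> y Ly; split=> //; case: sL.
  + by move=> y _ [].
  + move=> [y y'] [My My']; exists y' => //; split; first by rewrite /= subr0.
    by rewrite /= subrr; case: sL'.
Qed.

(** The complex is folded into its even and odd parts. With Z the cycles modulo L, exactness makes
    [D] an isomorphism from M/Z in one parity onto Z/L in the other, so both parities have dimension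
    dim Z/L (even) + dim Z/L (odd). *)
Lemma euler_char (V : lmodType R) (M L : bool -> V -> Prop) (D : V -> V) (e : bool -> nat) :
  (forall a u v, D (a *: u + v) = a *: D u + D v) -> (forall u, D (D u) = 0) ->
  (forall p, submod (M p)) -> (forall p, submod (L p)) -> (forall p y, L p y -> M p y) ->
  (forall p a y, m a -> M p y -> L p (a *: y)) ->
  (forall p y, M p y -> M (~~ p) (D y)) -> (forall p y, L p y -> L (~~ p) (D y)) ->
  (forall p z, M p z -> L (~~ p) (D z) -> exists2 w, M (~~ p) w & L p (z - D w)) ->
  (forall p, resdim (M p) (L p) (e p)) -> e true = e false.
Proof.
move=> DP DD sM sL LM mML DM DL exact Me.
pose Z p z := M p z /\ L (~~ p) (D z).
have sZ p : submod (Z p).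
  have [M0 MD MZ] := sM p; have [L0 LD LZ] := sL (~~ p).
  have D0 : D 0 = 0 by have := DP (-1) 0 0; rewrite !scaleN1r oppr0 !addr0 addNr.
  split=> [|u v [Mu Lu] [Mv Lv]|r u [Mu Lu]]; split; auto.
  - by rewrite D0.
  - by have := DP 1 u v; rewrite !scale1r => ->; apply: LD.
  - by have := DP r u 0; rewrite D0 !addr0 => ->; apply: LZ.
have LZ p y : L p y -> Z p y by move=> Ly; split; [apply: LM|apply: DL].
have [a0 Ha0] := resdim_quot (sZ false) (@LZ false) (Me false).
have [a1 Ha1] := resdim_quot (sZ true) (@LZ true) (Me true).
have bd p k : resdim (M (~~ p)) (Z (~~ p)) k -> resdim (Z p) (L p) k.
  apply: (resdim_iso (f := D)) => //.
  - move=> y My; split; first by have := DM _ _ My; rewrite negbK.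
    by rewrite DD; case: (sL (~~ p)).
  - by move=> y [_]; rewrite negbK.
  - by move=> y My Ly; split=> //; rewrite negbK.
  - by move=> y [My Ly]; apply: exact.
have E p k l : resdim (M p) (Z p) k -> resdim (Z p) (L p) l -> e p = (k + l)%N.
  move=> H1 H2; apply: (resdim_uniq (M := M p) (sL p)) => //.
  by apply: (resdim_add (N := Z p)) => // [y|y []//|a y]; [apply: LZ|apply: mML].
by rewrite (E true a1 a0) ?(E false a0 a1) 1?addnC //; apply: bd.
Qed.

End ResidueDimension.

(** * The linear recurrence for the Hilbert function *)

Section HilbertRecurrence.
Local Open Scope ring_scope.
Variable R : comNzRingType.
Hypothesis nR : noetherian R.
Variable m : R -> Prop.
Hypothesis locR : local_with m.
Let im := local_ideal locR.

Definition is_hilbert J (H : nat -> nat) :=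
  forall n, resdim (V := R^o) m (isum (ipow m n) J) (isum (ipow m n.+1) J) (H n).

Lemma ideal_submod (I : R -> Prop) : is_ideal I -> submod (V := R^o) I.
Proof. by case. Qed.

Lemma hilbert_funE J n r :
  hilbert_fun m J n r <-> resdim (V := R^o) m (isum (ipow m n) J) (isum (ipow m n.+1) J) r.
Proof.
pose sq (c : 'I_r -> R) := [seq c i | i <- enum 'I_r].
have szsq c : size (sq c) = r by rewrite size_map size_enum_ord.
have nthsq c (i : 'I_r) : (sq c)`_i = c i.
  by rewrite (nth_map i) ?size_enum_ord // nth_ord_enum.
split=> [[s [szs Fs inds sps]]|[s [[Fs sps] inds]]].
  exists (fun i : 'I_r => s`_i); split; first split.
  - by move=> i; apply: Fs; apply: mem_nth; rewrite szs.
  - by move=> y /sps[c [_ Fc]]; exists (fun i => c`_i).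
  - move=> c Fc i; rewrite -nthsq; apply: inds => //.
    by under eq_bigr => k _ do rewrite nthsq.
exists (sq s); split=> //.
- by move=> x /mapP[i _ ->].
- move=> c szc Fc i ir; apply: (inds (fun i => c`_i) _ (Ordinal ir)).
  by under eq_bigr => k _ do rewrite -nthsq.
- move=> y /sps[c Fc]; exists (sq c); split=> //.
  by under eq_bigr => k _ do rewrite !nthsq.
Qed.

Lemma hilbert_exists J : is_ideal J -> exists H, is_hilbert J H.
Proof.
move=> iJ; have ex n : exists r, resdim (V := R^o) m (isum (ipow m n) J) (isum (ipow m n.+1) J) r.
  have [xs [nxs gxs]] := noetherian_fg nR (ipow_ideal n im).
  have sF := ideal_submod (powsum_ideal n.+1 im iJ).
  have : spans (V := R^o) (isum (ipow m n) J) (isum (ipow m n.+1) J) (fun i : 'I_(size xs) => xs`_i).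
    split=> [i|y [u [v [/gxs[c ->] Jv ->]]]].
      by apply: isum_l => //; apply: nxs; apply: mem_nth.
    exists (fun i => c i); rewrite addrC addKr.
    by apply: isum_r => //; apply: ipow_ideal.
  exact: (spans_resdim (local_unit nR locR) sF).
exists (fun n => epsilon (inhabits 0%N) (resdim (V := R^o) m (isum (ipow m n) J) (isum (ipow m n.+1) J))) => n.
exact: epsilon_spec (ex n).
Qed.

Lemma kall_submod deg d F : kideal F -> submod (kall deg F : koszul R d -> Prop).
Proof.
move=> iF; split; first by apply: kall0 => i w; apply: ideal0.
- by move=> u v; apply: kaddD; apply: kideal_kadd.
- by move=> r u; apply: kallZ => i w y; apply: idealM.
Qed.

Definition kpar J n (p : bool) (i w : nat) (y : R) :=
  if odd i == p then isum (ipow m (n - w)) J y else y = 0.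

Lemma kpar_ideal J n p : is_ideal J -> kideal (kpar J n p).
Proof.
move=> iJ i w; rewrite /kpar; case: (odd i == p); first exact: powsum_ideal.
by split=> // [? ? -> ->|? ? ->]; rewrite ?addr0 ?mulr0.
Qed.

Lemma kpar_leq J n n' p i w y : (n <= n')%N -> kpar J n' p i w y -> kpar J n p i w y.
Proof.
by move=> nn; rewrite /kpar; case: ifP => // _; apply: powsum_leq => //; apply: leq_sub2r.
Qed.

Lemma kpar_mul J n p i w a y : is_ideal J -> m a -> kpar J n p i w y -> kpar J n.+1 p i w (a * y).
Proof.
move=> iJ ma; rewrite /kpar; case: ifP => _ => [Fy|->]; last by rewrite mulr0.
apply: (@powsum_leq _ _ _ _ (1 + (n - w))) => //; first by clear; lia.
by apply: powsum_mul => //; apply: isum_l => //; apply: ipow1.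
Qed.

Variable deg : nat -> nat.

(** The sum of H(n - sum of deg j over j in S), over subsets S of {0, ..., d-1} with an odd number
    of elements if [p], an even number otherwise. *)
Fixpoint parity_dim (H : nat -> nat) d (p : bool) n : nat :=
  if d is d'.+1 then (parity_dim H d' p n + parity_dim H d' (~~ p) (n - deg d'))%N
  else if p then 0 else H n.

(** The lower bound on n keeps all weights <= n. Beyond that, truncated subtraction would count H(0)
    for a component whose quotient is zero. *)
Lemma parity_dimP J H : is_ideal J -> is_hilbert J H -> forall d p n,
  (\sum_(j < d) deg j <= n)%N ->
  resdim m (kall deg (kpar J n p) : koszul R d -> Prop) (kall deg (kpar J n.+1 p)) (parity_dim H d p n).
Proof.
move=> iJ HH; elim=> [|d IH] p n degn /=.
  rewrite /kpar /= !subn0; case: p => /=; last exact: HH.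
  exists (fun=> 0); split; last by move=> c _ [].
  by split=> // y ->; exists (fun=> 0); rewrite big_ord0 subr0.
rewrite big_ord_recr /= in degn.
have degdn : (deg d <= n)%N by apply: leq_trans degn; apply: leq_addl.
have shift k : (deg d <= k)%N -> forall b : koszul R d,
    kall deg (kpar J (k - deg d) (~~ p)) b <-> kall deg (fun i w => kpar J k p i.+1 (w + deg d)%N) b.
  move=> dk b; split; apply: kall_mono => i w y; rewrite /kpar /= -subnDA addnC;
    by case: (odd i); case: (p).
apply: (resdim_ext (M := fun z : koszul R d.+1 => kall deg (kpar J n p) z.1 /\ kall deg (kpar J (n - deg d) (~~ p)) z.2)
  (L := fun z : koszul R d.+1 => kall deg (kpar J n.+1 p) z.1 /\ kall deg (kpar J (n - deg d).+1 (~~ p)) z.2)).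
- by move=> z; split=> -[? ?]; split=> //; apply/shift.
- by move=> z; rewrite -subSn //; split=> -[? ?]; split=> //; apply/shift => //; apply: leqW.
have sk k q : submod (kall deg (kpar J k q) : koszul R d -> Prop) by apply: kall_submod; apply: kpar_ideal.
have lk k q (y : koszul R d) : kall deg (kpar J k.+1 q) y -> kall deg (kpar J k q) y.
  by apply: kall_mono => i w u; apply: kpar_leq.
have mk k q a (y : koszul R d) : m a -> kall deg (kpar J k q) y -> kall deg (kpar J k.+1 q) (a *: y).
  by move=> ma; apply: kallZ => i w u; apply: kpar_mul.
apply: resdim_prod => //; [exact: lk|exact: lk|by move=> a y; apply: mk|by move=> a y; apply: mk| |].
- by apply: IH; apply: leq_trans degn; apply: leq_addr.
- by apply: IH; rewrite leq_subRL // addnC.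
Qed.

Lemma parity_dim_eq J x d n H : is_ideal J -> is_hilbert J H ->
  (forall j, (j < d)%N -> ipow m (deg j) (x j)) -> (\sum_(j < d) deg j <= n)%N ->
  @gr_exact R m J d x deg n -> parity_dim H d true n = parity_dim H d false n.
Proof.
move=> iJ HH mx degn exn.
pose pr p (i _ : nat) (y : R) := if odd i == p then y else 0.
have prD p i w : {morph pr p i w : y y' / y + y'} by move=> y y'; rewrite /pr; case: ifP; rewrite ?addr0.
have prN p i w : {morph pr p i w : y / - y} by move=> y; rewrite /pr; case: ifP; rewrite ?oppr0.
have ik k q := kpar_ideal k q iJ.
have ak k q := kideal_kadd (ik k q).
have bdk k p (y : koszul R d) : kall deg (kpar J k p) y -> kall deg (kpar J k (~~ p)) (bd x y).
  apply: kall_bd => // i w j u jd; rewrite /kpar /=.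
  have -> : (~~ odd i == p) = (odd i == ~~ p) by case: (odd i); case: (p).
  case: ifP => _ => [Fu|->]; last by rewrite mulr0.
  apply: (@powsum_leq _ _ _ _ (deg j + (k - (w + deg j)))) => //; first by clear; lia.
  by apply: powsum_mul => //; apply: isum_l => //; apply: mx.
have kf k p (y : koszul R d) : kall deg (kpar J k p) y -> kfilt m J deg k y.
  apply: kall_mono => i w u; rewrite /kpar; case: ifP => // _ ->.
  by apply: ideal0; apply: powsum_ideal.
have fk k p (y : koszul R d) : kfilt m J deg k y -> kall deg (kpar J k p) (kmap deg (pr p) y).
  by move=> ny; apply: kall_kmap ny => i w u Fu; rewrite /kpar /pr; case: (odd i == p).
apply: (euler_char im (local_not1 locR) (local_unit nR locR)
  (M := fun p => kall deg (kpar J n p) : koszul R d -> Prop) (L := fun p => kall deg (kpar J n.+1 p))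
  (D := @bd R x d) (e := fun p => parity_dim H d p n)).
- exact: bdP.
- exact: bd_bd.
- by move=> p; apply: kall_submod.
- by move=> p; apply: kall_submod.
- by move=> p y; apply: kall_mono => i w u; apply: kpar_leq.
- by move=> p a y ma; apply: kallZ => i w u; apply: kpar_mul.
- exact: bdk.
- exact: bdk.
- move=> p z nz nbz; have [w nw zw] := exn z (kf _ _ _ nz) (kf _ _ _ nbz).
  (* The w given by exactness may mix parities; as the differential exchanges them, its part of
     parity [~~ p] suffices. *)
  exists (kmap deg (pr (~~ p)) w); first exact: fk.
  rewrite -[_ - _](subrKA (kmap deg (pr p) z)); apply: kaddD => //.
    apply: kall_sub_kmap nz => i v u; rewrite /kpar /pr; case: (odd i == p); last by move=> ->; rewrite subrr.
    by rewrite subrr => _; apply: ideal0; apply: powsum_ideal.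
  rewrite -[_ - _](subrKA (kmap deg (pr p) (bd x w))); apply: kaddD => //.
    by rewrite -kmapB //; apply: fk.
  apply: kmap_bd => // i v j u jd; rewrite /pr /=.
  have -> : (~~ odd i == ~~ p) = (odd i == p) by case: (odd i); case: (p).
  by case: (odd i == p); rewrite ?mulr0 subrr; exact: (ideal0 (ik n.+1 p i v)).
- by move=> p; apply: parity_dimP.
Qed.

Lemma parity_dim_ext H H' d p n : (forall k, (k <= n)%N -> H k = H' k) ->
  parity_dim H d p n = parity_dim H' d p n.
Proof.
elim: d p n => [|d IH] p n HH /=; first by case: p; rewrite ?HH.
by rewrite !IH // => k kn; apply: HH; apply: leq_trans kn (leq_subr _ _).
Qed.

(** Positive weights mean that the value at n enters only through the empty subset, once and in the
    even part. The identity is written with sums to stay in the natural numbers. *)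
Lemma parity_dim_lead H H' d p n : (forall j, (j < d)%N -> (0 < deg j <= n)%N) ->
  (forall k, (k < n)%N -> H k = H' k) ->
  (parity_dim H d p n + (if p then 0 else H' n) = parity_dim H' d p n + (if p then 0 else H n))%N.
Proof.
move=> + HH; elim: d p => [|d IH] p degn /=; first by case: p; rewrite // addnC.
have /andP[deg0 degd] := degn d (ltnSn d).
have -> : parity_dim H d (~~ p) (n - deg d) = parity_dim H' d (~~ p) (n - deg d).
  by apply: parity_dim_ext => k kn; apply: HH; move: kn deg0 degd; clear; lia.
by rewrite addnAC (IH p (fun j jd => degn j (ltnW jd))) addnAC.
Qed.

End HilbertRecurrence.

Section Perturbation.
Local Open Scope ring_scope.
Variable R : comNzRingType.
Hypothesis nR : noetherian R.
Variable m : R -> Prop.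
Hypothesis locR : local_with m.
Let im := local_ideal locR.

Lemma dim_quot_uniq I d d' : dim_quot (R := R) I d -> dim_quot I d' -> d = d'.
Proof.
have aux e e' : dim_quot I e -> dim_quot I e' -> (e <= e')%N.
  move=> [[P [H1 H2]] _] [_ H]; rewrite leqNgt; apply/negP => ee'; apply: H; exists P.
  by split=> i ie; [apply: H1|apply: H2]; apply: leq_trans ie ee'.
by move=> Hd Hd'; apply/eqP; rewrite eqn_leq !aux.
Qed.

Lemma powsum_perturb I J N n : (n <= N)%N -> is_ideal J ->
  (forall y, isum I (ipow m N) y -> isum J (ipow m N) y) ->
  forall y, isum (ipow m n) I y -> isum (ipow m n) J y.
Proof.
move=> nN iJ IJ; have iF := powsum_ideal n im iJ.
apply: isum_min => // y; first exact: isum_l.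
move=> Iy; have [|a [b [Ja Nb ->]]] := IJ y; first by apply: isum_l => //; apply: ipow_ideal.
apply: idealD => //; first by apply: isum_r => //; apply: ipow_ideal.
by apply: isum_l => //; apply: ipow_leq Nb.
Qed.

(** In degree n0 the relation for [I] holds for [J] up to an error in m^N, inside m m^n0, which
    Nakayama absorbs. Higher degrees follow by multiplying with m^(n - n0). *)
Lemma gr_params_perturb I J d x deg n0 N : is_ideal I -> is_ideal J -> (n0 < N)%N ->
  (forall y, isum I (ipow m N) y -> isum J (ipow m N) y) ->
  gr_params m I d x deg n0 -> gr_params m J d x deg n0.
Proof.
move=> iI iJ n0N IJ [H1 H2]; split=> // n y n0n.
pose B k y := exists b : nat -> R, (forall j, (j < d)%N -> ipow m (k - deg j) (b j)) /\
    J (y - \sum_(j < d) x j * b j).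
have iB k : is_ideal (B k).
  split.
  - exists (fun=> 0); split=> [j jd|]; first by apply: ideal0; apply: ipow_ideal.
    by rewrite big1 ?subr0 => [|j _]; [apply: ideal0|rewrite mulr0].
  - move=> u v [b [nb Jb]] [c [nc Jc]]; exists (fun j => b j + c j); split=> [j jd|].
      by apply: idealD; [apply: ipow_ideal|apply: nb|apply: nc].
    rewrite (eq_bigr (fun j : 'I_d => x j * b j + x j * c j)) => [|j _]; last by rewrite mulrDr.
    by rewrite big_split opprD addrACA; apply: idealD.
  - move=> r u [b [nb Jb]]; exists (fun j => r * b j); split=> [j jd|].
      by apply: idealM; [apply: ipow_ideal|apply: nb].
    rewrite (eq_bigr (fun j : 'I_d => r * (x j * b j))) => [|j _]; last by rewrite mulrCA.
    by rewrite -mulr_sumr -mulrBr; apply: idealM.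
have Bn0 : forall z, ipow m n0 z -> B n0 z.
  apply: (nakayama nR locR (ipow_ideal n0 im) (iB n0)) => z n0z.
  have [b [nb Ib]] := H2 n0 z (leqnn n0) n0z.
  have [|u [v [Ju Nv zE]]] := IJ (z - \sum_(j < d) x j * b j); first by apply: isum_l => //; apply: ipow_ideal.
  exists (z - v), v; split; last by rewrite subrK.
    by exists b; split=> //; rewrite addrAC zE addrK.
  exact: (@ipow_leq _ m n0.+1 N).
rewrite -{1}(subnKC n0n); move: y; apply: (ipow_min_add im (iB n)) => u v /Bn0[b [nb Jb]] nv.
exists (fun j => b j * v); split=> [j jd|].
  have [_ degn _] := H1 j jd; have -> : (n - deg j = (n0 - deg j) + (n - n0))%N.
    by move: n0n degn; clear; lia.
  by apply: ipow_mul => //; apply: nb.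
rewrite (eq_bigr (fun j : 'I_d => (x j * b j) * v)) => [|j _]; last by rewrite mulrA.
by rewrite -mulr_suml -mulrBl; apply: idealMR.
Qed.

End Perturbation.

Theorem theorem4p5 (R : comNzRingType) (m I : R -> Prop) :
  noetherian R -> local_with m -> is_ideal I ->
  exists N : nat, (0 < N)%N /\
    forall (J : R -> Prop) (d : nat), is_ideal J ->
      seteqR (isum I (ipow m N)) (isum J (ipow m N)) ->
      dim_quot J d -> dim_quot I d ->
      cohen_macaulay_quot m J ->
      gr_depth_ge m J (d - 1) ->
      forall n r : nat, hilbert_fun m I n r <-> hilbert_fun m J n r.
Proof.
move=> nR locR iI; have im := local_ideal locR.
case: (classic (exists d, dim_quot I d)) => [[d dimI]|nodim]; last first.
  (* If R/I has no finite dimension, condition (ii) cannot hold. *)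
  by exists 1; split=> // J d _ _ _ dimI; case: nodim; exists d.
have [x [deg [n0 xpar]]] := gr_params_exist nR locR iI dimI.2.
have [n1 exI] := gr_exact_eventually nR im iI xpar.
(* N > n0 is needed for Nakayama; n >= N then gives exactness for [J] (n0) and for [I] (n1), and
   makes all weights at most n. *)
exists (n0 + n1 + \sum_(j < d) deg j).+1; set N := (_ + _ + _).+1; split=> // J d' iJ IJ dimJ dimI'.
rewrite -(dim_quot_uniq dimI dimI') in dimJ *; move=> [t [[[xs [szxs regxs]] _] dimt]] [ys [dys regys]].
rewrite -(dim_quot_uniq dimJ dimt) in szxs.
have IJ1 y := (IJ y).1; have IJ2 y := (IJ y).2.
have n0N : n0 < N by rewrite /N; clear; lia.
have xparJ := gr_params_perturb nR locR iI iJ n0N IJ1 xpar.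
have exJ n : n0 <= n -> @gr_exact R m J d x deg n.
  apply: gr_exact_CM => //.
    by apply: (regseq_kvanish im iJ xparJ regxs); rewrite szxs.
  by apply: (gr_regseq_kvanish im iJ xparJ regys dys); clear; lia.
have [HI hI] := hilbert_exists nR locR iI; have [HJ hJ] := hilbert_exists nR locR iJ.
have uniq K H : is_ideal K -> is_hilbert m K H -> forall n r, hilbert_fun m K n r <-> r = H n.
  move=> iK hK n r; split=> [/hilbert_funE Kr|->]; last exact/hilbert_funE.
  apply: (resdim_uniq im (local_not1 locR) _ Kr (hK n)).
  by apply: ideal_submod; apply: powsum_ideal.
have mx j : j < d -> ipow m (deg j) (x j) by move=> /xpar.1[].
suff HIJ n : HI n = HJ n by move=> n r; rewrite (uniq I HI) // (uniq J HJ) // HIJ.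
(* For n < N the ideals I + m^k and J + m^k agree for k = n and k = n + 1; from N on the recurrence
   determines the value at n from earlier ones. *)
elim/ltn_ind: n => n IH; have [nN|Nn] := ltnP n N.
  apply: (resdim_uniq im (local_not1 locR) _ _ (hJ n)).
    by apply: ideal_submod; apply: powsum_ideal.
  have FE k : k <= N -> forall y, isum (ipow m k) I y <-> isum (ipow m k) J y.
    move=> kN y; split; first exact: powsum_perturb locR _ _ _ _ kN iJ IJ1 y.
    exact: powsum_perturb locR _ _ _ _ kN iI IJ2 y.
  by apply: resdim_ext (hI n) => y; apply: FE => //; apply: ltnW.
have degn : \sum_(j < d) deg j <= n by move: Nn; rewrite /N; clear; lia.
have := parity_dim_eq nR locR iI hI mx degn (exI n ltac:(move: Nn; rewrite /N; clear; lia)).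
have := parity_dim_eq nR locR iJ hJ mx degn (exJ n ltac:(move: Nn; rewrite /N; clear; lia)).
have lead j : j < d -> 0 < deg j <= n.
  move=> jd; have [-> degj _] := xpar.1 j jd; move: Nn degj; rewrite /N; clear; lia.
have := parity_dim_lead true lead IH; have := parity_dim_lead false lead IH.
by clear; lia.
Qed.
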